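(* Let $1<p<\infty$. (1) Let $\mathcal F$ be a combinatorial family. If $p\neq 2$, then every isometry of $X_{\mathcal F,p}^*$ is an $\mathcal F$-compatible signed permutation of $(e_i^* )$, and hence every isometry of $X_{\mathcal F,p}$ is an $\mathcal F$-compatible signed permutation of $(e_i)$. (2) Let $(\mathcal S_\alpha)_{0\leqslant\alpha<\omega_1}$ be a transfinite Schreier sequence. (a) If $p\neq 2$, then for every $1\leqslant\alpha<\omega_1$, all isometries of $X_{\mathcal S_\alpha,p}^*$ are diagonal. (b) If $p=2$, then for every successor ordinal $1\leqslant\alpha<\omega_1$ all isometries of $X_{\mathcal S_\alpha,2}$ are diagonal; and the same holds for every $1\leqslant\alpha<\omega_1$ if the sequence $(\mathcal S_\alpha)_{\alpha<\omega_1}$ is good.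
   Context: $\mathbb N=\{1,2,3,\dots\}$. Scalars are in $\mathbb K=\mathbb R$ or $\mathbb C$. ''Isometry'' always means linear surjective isometry. A sign is a scalar of modulus $1$. $c_{00}$ is the space of finitely supported scalar sequences, with canonical basis $(e_i)_{i\in\mathbb N}$. A combinatorial family is a family $\mathcal F$ of finite subsets of $\mathbb N$ that contains all singletons and is hereditary ($F\in\mathcal F$, $G\subset F$ imply $G\in\mathcal F$). For a combinatorial family $\mathcal F$ and $1<p<\infty$, $X_{\mathcal F,p}$ is the completion of $c_{00}$ for the norm $\|x\|_{\mathcal F,p}=\sup\{(\sum_{i\in F}|x(i)|^p)^{1/p};\ F\in\mathcal F\}$. Then $(e_i)$ is a $1$-unconditional shrinking Schauder basis of $X_{\mathcal F,p}$, so the coordinate functionals $(e_i^* )$ form a Schauder basis of $X_{\mathcal F,p}^*$. An $\mathcal F$-compatible signed permutation of $(e_i)$ (resp. of $(e_i^* )$) is an operator $J$ on $X_{\mathcal F,p}$ (resp. on $X_{\mathcal F,p}^*$) such that $Je_i=\omega_ie_{\pi(i)}$ (resp. $Je_i^*=\omega_ie_{\pi(i)}^*$) for all $i$, for some signs $(\omega_i)$ and some permutation $\pi$ of $\mathbb N$ with $\pi(\mathcal F)=\mathcal F$, where $\pi(\mathcal F)=\{\pi(F);F\in\mathcal F\}$. An isometry of $X_{\mathcal F,p}$ (resp. $X_{\mathcal F,p}^*$) is diagonal if $Je_i=\omega_ie_i$ (resp. $Je_i^*=\omega_ie_i^*$) for all $i$, for some signs $(\omega_i)$. For $n\in\mathbb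 N$ and finite $E,E'\subset\mathbb N$: $n\leqslant E$ means $n\leqslant i$ for all $i\in E$, and $E<E'$ means $i<i'$ for all $i\in E$, $i'\in E'$ (both hold trivially with empty sets). A transfinite Schreier sequence is a transfinite sequence $(\mathcal S_\alpha)_{0\leqslant\alpha<\omega_1}$ of families of finite subsets of $\mathbb N$ ($\omega_1$ the first uncountable ordinal) such that: $\mathcal S_0=\{F\subset\mathbb N;|F|\leqslant1\}$; $\mathcal S_{\beta+1}$ is the set of all unions $\bigcup_{i=1}^nE_i$ with $n\in\mathbb N$, $E_i\in\mathcal S_\beta$ (possibly empty), $n\leqslant E_i$ for all $i$ and $E_i<E_j$ for $i<j$; and for $\alpha$ a limit ordinal, $\mathcal S_\alpha=\{F\subset\mathbb N;\ F\in\mathcal S_{\alpha_n}\text{ for some }n\leqslant F\}$, where $(\alpha_n)_{n\in\mathbb N}$ (the approximating sequence of $\alpha$) is a preassigned strictly increasing sequence of ordinals with $\sup_n\alpha_n=\alpha$. For $\alpha\geqslant 1$ each $\mathcal S_\alpha$ is a combinatorial family. The sequence $(\mathcal S_\alpha)$ is good if for every limit ordinal $\alpha<\omega_1$ the approximating sequence consists of successor ordinals, $\alpha_n=\beta_n+1$, and the sequence $(\mathcal S_{\beta_n})_{n\in\mathbb N}$ is increasing for inclusion. *)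

(* Defs.v *)
From HB Require Import structures.
From mathcomp Require Import all_boot all_order all_algebra.
From mathcomp Require Import finmap.
From mathcomp Require Import complex.
From mathcomp Require Import all_classical all_reals all_analysis.
Import Order.TTheory GRing.Theory Num.Theory.
Import numFieldNormedType.Exports.

Set Implicit Arguments.
Unset Strict Implicit.
Unset Printing Implicit Defensive.

Local Open Scope classical_set_scope.
Local Open Scope ring_scope.

(* The positive integers {1, 2, 3, ...} are represented by nat through the
   order isomorphism k |-> k.+1: the index k : nat stands for the integer k + 1.
   This applies to the positions of coordinates, to the elements of the members
   of a family, and to the integers n in the definition of the Schreier
   families; only "n sets" then has to be read as n.+1 sets. *)

Variant scalar_kind := RealScalars | ComplexScalars.

Definition scalar_field (R : realType) (s : scalar_kind) : numFieldType :=
  match s with RealScalars => R | ComplexScalars => complex R end.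

(* In MathComp the norm of a vector over K is an element of K, here always a
   nonnegative real one; realpart brings it back to R. *)
Definition realpart (R : realType) (s : scalar_kind) : scalar_field R s -> R :=
  match s with
  | RealScalars => fun x => x
  | ComplexScalars => fun z => complex.Re z
  end.

Section FinitelySupportedSequences.
Variable K : numFieldType.

Definition finitely_supported : {pred nat -> K^o} :=
  fun x => `[< finite_set [set i | x i != 0] >].

Fact finitely_supported_submod_closed : submod_closed finitely_supported.
Proof.
split.
  apply/asboolP; suff -> : [set i | (0 : nat -> K^o) i != 0] = set0 by [].
  by apply/seteqP; split => i //=; rewrite eqxx.
move=> a x y /asboolP hx /asboolP hy; apply/asboolP.
apply: (@sub_finite_set _ _
  ([set i | x i != 0] `|` [set i | y i != 0])); last by rewrite finite_setU.
move=> i /=; have [xi0|] := eqVneq (x i) 0; last by left.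
have [yi0|] := eqVneq (y i) 0; last by right.
by rewrite -[(a *: x + y) i]/(a *: x i + y i) xi0 yi0 scaler0 addr0 eqxx.
Qed.

HB.instance Definition _ := GRing.isSubmodClosed.Build K (nat -> K^o)
  finitely_supported finitely_supported_submod_closed.

Record c00 := C00 {
  c00_val :> nat -> K^o;
  c00_valP : c00_val \in finitely_supported }.

HB.instance Definition _ := [isSub for c00_val].
HB.instance Definition _ := [Choice of c00 by <:].
HB.instance Definition _ := [SubChoice_isSubLmodule of c00 by <:].

Fact c00_basis_subproof (i : nat) :
  (fun j => (j == i)%:R : K^o) \in finitely_supported.
Proof.
apply/asboolP; apply: (@sub_finite_set _ _ [set i]) => // j /=.
by case: (eqVneq j i) => //; rewrite eqxx.
Qed.

Definition c00_basis (i : nat) : c00 := C00 (c00_basis_subproof i).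

End FinitelySupportedSequences.

Section ContinuousDual.
Variables (K : numFieldType) (X : normedModType K).

Definition continuous_linear_form : {pred X -> K^o} :=
  fun f => `[< linear f /\ continuous f >].

Fact continuous_linear_form_submod_closed : submod_closed continuous_linear_form.
Proof.
split.
  apply/asboolP; split; last by move=> x; exact: cvg_cst.
  by move=> a x y /=; rewrite -[RHS]/(a *: 0 + 0) scaler0 addr0.
move=> a f g /asboolP[lf cf] /asboolP[lg cg]; apply/asboolP; split.
  move=> b x y; rewrite -!/((a *: f + g) _).
  rewrite -![(a *: f + g) _]/(a *: f _ + g _) lf lg !scalerDr !scalerA.
  by rewrite [a * b]mulrC addrACA.
by move=> x; apply: cvgD; [apply: cvgZl_tmp; exact: cf|exact: cg].
Qed.

HB.instance Definition _ := GRing.isSubmodClosed.Build K (X -> K^o)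
  continuous_linear_form continuous_linear_form_submod_closed.

Record dual_space := Dual {
  dual_val :> X -> K^o;
  dual_valP : dual_val \in continuous_linear_form }.

HB.instance Definition _ := [isSub for dual_val].
HB.instance Definition _ := [Choice of dual_space by <:].
HB.instance Definition _ := [SubChoice_isSubLmodule of dual_space by <:].

End ContinuousDual.

Section CombinatorialBanachSpaces.
Variables (R : realType) (s : scalar_kind).
Local Notation K := (scalar_field R s).

Definition vnorm (X : normedModType K) (x : X) : R := realpart `|x|.

Definition dual_norm (X : normedModType K) (f : dual_space X) : R :=
  sup [set realpart `|f x| | x in [set x : X | vnorm x <= 1]].

Definition is_isometry (V : lmodType K) (N : V -> R) (J : V -> V) : Prop :=
  [/\ linear J, (forall y, exists x, J x = y) & forall x, N (J x) = N x].

Definition combinatorial (F : set {fset nat}) : Prop :=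
  (forall i, F [fset i]%fset) /\
  (forall A B : {fset nat}, F A -> (B `<=` A)%fset -> F B).

Definition family_norm (F : set {fset nat}) (p : R) (x : nat -> K) : R :=
  sup [set (\sum_(i <- A) realpart `|x i| `^ p) `^ p^-1 | A in F].

(* X, together with iota, is the completion X_{F,p} of c00. *)
Definition is_completion (F : set {fset nat}) (p : R)
    (X : completeNormedModType K) (iota : {linear c00 K -> X}) : Prop :=
  (forall x : c00 K, vnorm (iota x) = family_norm F p x) /\
  dense (range iota).

Definition unit_vector (X : completeNormedModType K)
  (iota : {linear c00 K -> X}) (i : nat) : X := iota (c00_basis K i).

(* This determines es: the span of the e_i is dense in X, and |x i| <= ||x||
   for x in c00 because the family contains the singletons. *)
Definition coordinate_functionals (X : completeNormedModType K)
    (iota : {linear c00 K -> X}) (es : nat -> dual_space X) : Prop :=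
  forall i j, es i (unit_vector iota j) = (i == j)%:R.

Definition family_image (pi : nat -> nat) (F : set {fset nat}) :
  set {fset nat} := [set [fset pi i | i in A]%fset | A in F].

Definition compatible_signed_permutation (F : set {fset nat})
    (V : lmodType K) (b : nat -> V) (J : V -> V) : Prop :=
  exists (omega : nat -> K) (pi : nat -> nat),
    [/\ forall i, `|omega i| = 1, bijective pi, family_image pi F = F
      & forall i, J (b i) = omega i *: b (pi i)].

Definition diagonal_operator (V : lmodType K) (b : nat -> V) (J : V -> V) : Prop :=
  exists omega : nat -> K,
    (forall i, `|omega i| = 1) /\ (forall i, J (b i) = omega i *: b i).

End CombinatorialBanachSpaces.

Definition fset_ge (n : nat) (A : {fset nat}) : Prop :=
  forall i, i \in A -> (n <= i)%N.

Definition fset_lt (A B : {fset nat}) : Prop :=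
  forall i j, i \in A -> j \in B -> (i < j)%N.

Section CountableOrdinals.
Variables (d : Order.disp_t) (W : orderType d).

(* W is order isomorphic to omega_1, i.e. its elements are the countable
   ordinals: an uncountable well-order whose proper initial segments are
   countable. *)
Definition is_omega1 : Prop :=
  [/\ well_founded (fun a b : W => (a < b)%O),
      forall a : W, countable [set b : W | (b < a)%O]
    & ~ countable [set: W]].

Definition ord_zero (a : W) : Prop := forall b : W, (a <= b)%O.

Definition ord_succ (b a : W) : Prop :=
  (b < a)%O /\ forall c : W, (b < c)%O -> (a <= c)%O.

Definition successor_ordinal (a : W) : Prop := exists b, ord_succ b a.

Definition limit_ordinal (a : W) : Prop :=
  ~ ord_zero a /\ ~ successor_ordinal a.

(* Unions of n.+1 successive, possibly empty, members of S lying above n: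
   n stands for the positive integer n + 1. *)
Definition schreier_step (S : set {fset nat}) : set {fset nat} :=
  [set A | exists (n : nat) (E : 'I_n.+1 -> {fset nat}),
    [/\ forall i, S (E i), forall i, fset_ge n (E i),
        forall i j : 'I_n.+1, (i < j)%N -> fset_lt (E i) (E j)
      & A = \big[fsetU/fset0]_(i < n.+1) E i]].

(* approx a is the approximating sequence of a; its values at ordinals that are
   not limits are irrelevant. *)
Definition transfinite_schreier (S : W -> set {fset nat})
    (approx : W -> nat -> W) : Prop :=
  [/\ forall a, ord_zero a -> S a = [set A | (#|` A| <= 1)%N],
      forall b a, ord_succ b a -> S a = schreier_step (S b),
      forall a, limit_ordinal a ->
        {homo approx a : m n / (m < n)%N >-> (m < n)%O} /\
        supremums (range (approx a)) a
    & forall a, limit_ordinal a ->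
        S a = [set A | exists n, fset_ge n A /\ S (approx a n) A]].

Definition good_schreier (S : W -> set {fset nat}) (approx : W -> nat -> W) : Prop :=
  forall a, limit_ordinal a ->
    exists b : nat -> W, (forall n, ord_succ (b n) (approx a n)) /\
      (forall m n, (m <= n)%N -> S (b m) `<=` S (b n)).

End CountableOrdinals.

(* Main.v *)
(* Let q be the conjugate exponent of p. In the dual ball, a functional
   f = sum_(i in A) a_i e_i^* with A in F and |a|_q = 1 is strongly exposed by an
   element x of X. If J is an isometry of the dual, then J f is strongly exposed by
   f' |-> (J^-1 f') x; as the basis is shrinking, this functional is also almost
   normed by elements of the l_q-spheres over members of F, and J f is a norm limit
   of these. Hence J f is a unit vector of l_q all of whose finite subsupports lie
   in F.

   For p <> 2 the functionals J e_i^* have pairwise disjoint supports: if {i, j} is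
   in F by the equality case of Clarkson's inequality, and otherwise because
   J e_i^* +- J e_j^* have norm 2, so that one vector almost norms both summands.
   The same holds for J^-1, and J permutes the e_i^* up to signs.

   For the Schreier families, and for every p, let A_k be the support of J e_k^*.
   If H is in S_a, then so are the finite subsets of the union of the A_k, k in H.
   The sets of S_a containing j have a larger Cantor-Bendixson rank than those
   containing some i < j, and comparing ranks gives A_k >= k; the same for J^-1
   gives k in A_k. Comparing the ways to split a set containing k into k sets of
   lower families, the transport property descends from S_a to lower and lower
   families, and finally to S_0, where it says that A_k = {k}. *)

Require Import Defs.
From HB Require Import structures.
From mathcomp Require Import all_boot all_order all_algebra.
From mathcomp Require Import finmap complex ring lra.
From mathcomp Require Import all_classical all_reals all_analysis.
Import Order.TTheory GRing.Theory Num.Theory.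
Import numFieldNormedType.Exports.

Set Implicit Arguments.
Unset Strict Implicit.
Unset Printing Implicit Defensive.

Local Open Scope classical_set_scope.

(** * Schreier families *)

Section SchreierFamilies.
Local Open Scope fset_scope.

(** The completion need not be reflexive, so the functional [f' |-> (J^-1 f') x] need not be
    evaluation at a vector of [X]. Truncating its sequence of coordinates gives vectors [y] of [X];
    since [J f] is the norm limit of its own truncations, it still almost reaches 1 at some [y], and
    the norm formula for finite combinations then supplies a member of the family. Only almost
    norming elements are available, hence strong exposure and a quantitative equality case of
    Young's inequality.

    For p = 2 Clarkson's inequality is an identity and yields no disjointness. What remains is that
    a generic combination of the images of the coordinate functionals over H is nonzero on any
    prescribed finite part of the union of their supports, so that the support theorem applies to
    the whole union.

    The families [S b] need not increase with [b]: in general inclusion holds only for sets far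
    enough out. Ranks are therefore never compared abstractly; a family is compared with a finite
    list of others, on sets lying beyond a bound. *)

Definition hereditary (S : set {fset nat}) : Prop :=
  forall A B : {fset nat}, S A -> B `<=` A -> S B.

Lemma leq_fset_max (A : {fset nat}) i : i \in A -> (i <= \max_(k <- A) k)%N.
Proof.
move=> iA; have {}iA : i \in enum_fset A by [].
exact: (@leq_bigmax_seq nat _ xpredT (fun k => k)).
Qed.

Fixpoint blocks (S : set {fset nat}) (n : nat) : set {fset nat} :=
  if n is n'.+1 then
    [set A | exists E D, [/\ S E, blocks S n' D, fset_lt E D & A = E `|` D]]
  else [set fset0].

Lemma blocks_hereditary S n :
  hereditary S -> hereditary (blocks S n).
Proof.
move=> hS; elim: n => [|n IH] A B /=; first by move=> -> /[!fsubset0] /eqP.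
move=> [E [D [SE SD ED ->]]] sB; exists (E `&` B), (D `&` B); split.
- by apply: (hS _ _ SE); apply: fsubsetIl.
- by apply: (IH _ _ SD); apply: fsubsetIl.
- by move=> i j /fsetIP[iE _] /fsetIP[jD _]; apply: ED.
- by rewrite -fsetIUl; apply/esym/fsetIidPr.
Qed.

Lemma blocks_leq S m n : S fset0 -> (m <= n)%N -> (blocks S m `<=` blocks S n)%classic.
Proof.
move=> S0 /subnK <-; elim: (n - m)%N => [//|k IH] A /IH SA /=.
by exists fset0, A; split; rewrite ?fset0U // => i j; rewrite in_fset0.
Qed.

Lemma sub_blocks S n : S fset0 -> (S `<=` blocks S n.+1)%classic.
Proof.
move=> S0 A SA; apply: (@blocks_leq _ 1) => //=.
by exists A, fset0; split; rewrite ?fsetU0 // => i j; rewrite in_fset0.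
Qed.

Lemma blocksP S n A : blocks S n A <->
  exists E : nat -> {fset nat}, [/\ forall i, (i < n)%N -> S (E i),
    forall i j, (i < j)%N -> (j < n)%N -> fset_lt (E i) (E j)
    & A = \big[fsetU/fset0]_(i < n) E i].
Proof.
elim: n A => [|n IH] A /=.
  split=> [->|[E [_ _ ->]]]; last by rewrite big_ord0.
  by exists (fun=> fset0); split; rewrite ?big_ord0.
split=> [[E [D [SE /IH[E' [SE' ltE' ->]] ED ->]]]|[E [SE ltE ->]]].
  exists (fun i => if i is i'.+1 then E' i' else E); split.
  - by case=> // i; rewrite ltnS => /SE'.
  - case=> [|i] [|j] //; last by rewrite !ltnS; apply: ltE'.
    move=> _ jn a b aE bE; apply: ED => //; have {}jn : (j < n)%N by [].
    by apply/bigfcupP; exists (Ordinal jn) => //; rewrite mem_index_enum.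
  - by rewrite big_ord_recl.
exists (E 0), (\big[fsetU/fset0]_(i < n) E i.+1); split.
- exact: SE.
- apply/IH; exists (fun i => E i.+1); split=> // [i|i j] ilt; first exact: SE.
  by move=> jlt; apply: ltE.
- move=> a b aE /bigfcupP[i _ bE]; apply: (ltE 0 i.+1) => //.
  by rewrite ltnS.
- by rewrite big_ord_recl.
Qed.

Lemma schreier_stepP S A :
  schreier_step S A <-> exists n, fset_ge n A /\ blocks S n.+1 A.
Proof.
split=> [[n [E [SE geE ltE ->]]]|[n [geA /blocksP[E [SE ltE AE]]]]].
  exists n; split; first by move=> a /bigfcupP[i _ /geE].
  apply/blocksP; exists (fun i => E (inord i)); split=> //.
    move=> i j ij jn; apply: ltE; rewrite !inordK //.
    exact: leq_trans (ltnW _) jn.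
  by apply: eq_bigr => i _; rewrite inord_val.
exists n, (fun i => E i); split=> // [i|i|i j ij].
- exact: SE.
- move=> a aE; apply: geA; rewrite AE; apply/bigfcupP.
  by exists i => //; rewrite mem_index_enum.
- exact: ltE.
Qed.

Lemma schreier_step_hereditary S :
  hereditary S -> hereditary (schreier_step S).
Proof.
move=> hS A B /schreier_stepP[n [geA bA]] BA; apply/schreier_stepP; exists n.
split; last exact: blocks_hereditary hS _ _ bA BA.
by move=> i /(fsubsetP BA); apply: geA.
Qed.

Lemma sub_schreier_step S : S fset0 -> (S `<=` schreier_step S)%classic.
Proof.
move=> S0 A SA; apply/schreier_stepP; exists 0%N.
by split; [|apply: sub_blocks].
Qed.

(** The least element of [A] bounds the number of blocks, so any element [x] does too; empty blocks
    fill up to [n.+1]. *)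
Lemma schreier_step_blocks S A x n : S fset0 ->
  schreier_step S A -> x \in A -> (x <= n)%N -> blocks S n.+1 A.
Proof.
move=> S0 /schreier_stepP[m [mA bA]] xA xn; apply: blocks_leq bA => //.
by rewrite ltnS; apply: leq_trans xn; apply: mA.
Qed.

(** * Sets that leave a family once an earlier point is adjoined *)

Section Escape.
Variable r : nat -> nat -> Prop.

(** In the application [r k g] says that g is in the support of the image of the k-th coordinate
    functional, and [G] is a finite part of the union of these supports over [H]. *)
Definition linked (H G : {fset nat}) : Prop :=
  forall g, g \in G -> exists2 k, k \in H & r k g.

Lemma linkedU H G H' G' :
  linked H G -> linked H' G' -> linked (H `|` H') (G `|` G').
Proof.
by move=> l l' g /fsetUP[/l|/l'] [k kH rk]; exists k => //; rewrite in_fsetU kH ?orbT.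
Qed.

Definition wide : Prop :=
  forall N, exists k g, [/\ (N < k)%N, (N < g)%N & r k g].

(* The positional substitute for "the families in P have smaller rank than T
   (through r)": T contains sets H, arbitrarily far out, to which some G is
   linked such that no member of P contains G and a point before it. *)
Definition escapes (T : set {fset nat}) (P : set (set {fset nat})) : Prop :=
  forall N, exists H G, [/\ T H, fset_ge N.+1 H, linked H G, fset_ge N.+1 G
    & forall x B, (x <= N)%N -> P B -> ~ B (x |` G)].

(** A second set [G'] is placed beyond everything chosen for the first block. In a decomposition
    [E], [D] of the whole, some point y among x and [G] misses [E]; then y and all of [G'] lie in
    [D], and y is the early point for the induction. *)
Lemma blocks_escape T (P : set (set {fset nat})) n :
  (forall B, P B -> hereditary B) -> escapes T P ->
  escapes (blocks T n) [set blocks B n | B in P].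
Proof.
move=> hP eTP; elim: n => [|n IH] N.
  exists fset0, fset0; split=> //; try by move=> i; rewrite in_fset0.
  move=> x _ _ [B _ <-] /= xG; have := fset1U1 x fset0.
  by rewrite xG in_fset0.
have [H [G [TH geH lHG geG escG]]] := eTP N.
pose N' := maxn N (\max_(i <- H `|` G) i).
have N'P i : i \in H `|` G -> (i <= N')%N.
  by move=> iHG; rewrite leq_max leq_fset_max ?orbT.
have NN' : (N <= N')%N by rewrite leq_maxl.
have [H' [G' [TH' geH' lHG' geG' escG']]] := IH N'.
exists (H `|` H'), (G `|` G'); split.
- exists H, H'; split=> // a b aH bH'; apply: leq_trans (geH' _ bH').
  by rewrite ltnS N'P // in_fsetU aH.
- move=> i /fsetUP[/geH //|/geH']; exact: leq_trans.
- exact: linkedU.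
- move=> i /fsetUP[/geG //|/geG']; exact: leq_trans.
move=> x _ xN [B PB <-] /= [E [D [BE BD ED xGE]]].
have : ~ (x |` G `<=` E).
  by move=> sE; apply: (escG _ _ xN PB); apply: hP sE.
apply; apply/fsubsetP => y yxG; apply: contrapT => /negP yE.
have yN' : (y <= N')%N.
  move: yxG => /fset1UP[->|yG]; first exact: leq_trans NN'.
  by rewrite N'P // in_fsetU yG orbT.
have yD : y \in D.
  have : y \in E `|` D by rewrite -xGE fsetUA in_fsetU yxG.
  by rewrite in_fsetU (negPf yE).
apply: (escG' y (blocks B n) yN'); first by exists B.
apply: (blocks_hereditary (hP _ PB) BD); apply/fsubsetP => z.
move=> /fset1UP[->//|zG'].
have : z \in E `|` D by rewrite -xGE !in_fsetU zG' !orbT.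
move=> /fsetUP[zE|//]; have := ED _ _ zE yD.
by rewrite ltnNge (leq_trans yN') // ltnW // geG'.
Qed.

End Escape.

Section Transfinite.
Variables (d : Order.disp_t) (W : orderType d).
Variables (S : W -> set {fset nat}) (approx : W -> nat -> W).
Hypotheses (hW : is_omega1 W) (hS : transfinite_schreier S approx).

Let W_wf : well_founded (fun a b : W => (a < b)%O).
Proof. by case: hW. Qed.

Variant ordinal_spec (a : W) : Prop :=
| OrdinalZero of ord_zero a & S a = [set A | (#|` A| <= 1)%N]
| OrdinalSucc b of ord_succ b a & S a = schreier_step (S b)
| OrdinalLimit of limit_ordinal a
    & (forall m n, (m <= n)%N -> (approx a m <= approx a n)%O)
    & (forall n, (approx a n < a)%O)
    & (forall c, (c < a)%O -> exists n, (c <= approx a n)%O)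
    & (approx a 0 < approx a 1)%O
    & S a = [set A | exists n, fset_ge n A /\ S (approx a n) A].

Lemma ordinalP a : ordinal_spec a.
Proof.
have [S0 Ssucc Slim1 Slim2] := hS.
have [az|az] := pselect (ord_zero a); first by apply: OrdinalZero az (S0 _ az).
have [[b ba]|asucc] := pselect (successor_ordinal a).
  exact: OrdinalSucc ba (Ssucc _ _ ba).
have alim : limit_ordinal a by [].
have [incr [ub lub]] := Slim1 _ alim.
apply: OrdinalLimit => //.
- by move=> m n; rewrite leq_eqVlt => /predU1P[->//|/incr/ltW].
- move=> n; apply: lt_le_trans (incr n n.+1 _) _ => //.
  by apply: ub; exists n.+1.
- move=> c ca; apply: contrapT => nc; move: ca; rewrite ltNge; apply/negP.
  rewrite negbK; apply: lub => _ [n _ <-]; rewrite leNgt; apply/negP => cn.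
  by apply: nc; exists n; apply: ltW.
- exact: incr.
- exact: Slim2.
Qed.

Lemma schreier_hereditary a : hereditary (S a).
Proof.
elim/(well_founded_ind W_wf): a => a IH.
case: (ordinalP a) => [_ ->|b [ba _] ->|_ _ lta _ _ ->].
- by move=> A B /= A1 /fsubset_leq_card /leq_trans; apply.
- by apply: schreier_step_hereditary; apply: IH.
- move=> A B /= [n [nA SA]] BA; exists n; split.
    by move=> i /(fsubsetP BA); apply: nA.
  by apply: IH SA BA.
Qed.

Lemma schreier1 a i : S a [fset i].
Proof.
elim/(well_founded_ind W_wf): a i => a IH i.
have S0 b : (b < a)%O -> S b fset0.
  by move=> ba; apply: (schreier_hereditary (IH b ba 0%N)); apply: fsub0set.
case: (ordinalP a) => [_ ->|b [ba _] ->|_ _ lta _ _ ->].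
- by rewrite /= cardfs1.
- by apply: sub_schreier_step; [apply: S0|apply: IH].
- by exists 0%N; split => //; apply: IH.
Qed.

Lemma schreier0 a : S a fset0.
Proof. by apply: (schreier_hereditary (schreier1 a 0)); apply: fsub0set. Qed.

Lemma schreier_combinatorial a : combinatorial (S a).
Proof. by split; [apply: schreier1|apply: schreier_hereditary]. Qed.

Lemma ord_succ_exists (c e : W) : (c < e)%O -> exists2 b, ord_succ c b & (b <= e)%O.
Proof.
move=> ce; have [b [cb minb]] :
    exists b, (c < b)%O /\ forall b', (c < b')%O -> (b <= b')%O.
  elim/(well_founded_ind W_wf): e ce => e IH ce.
  have [[b [be cb]]|nb] := pselect (exists b, (b < e)%O /\ (c < b)%O).
    exact: IH be cb.
  exists e; split=> // b' cb'; rewrite leNgt; apply/negP => b'e.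
  by apply: nb; exists b'.
by exists b => //; apply: minb.
Qed.

Lemma ord_succ_le (b a c : W) : ord_succ b a -> (c < a)%O -> (c <= b)%O.
Proof.
by move=> [_ minb] ca; rewrite leNgt; apply/negP => /minb; rewrite leNgt ca.
Qed.

Lemma schreier_succ b a : ord_succ b a -> S a = schreier_step (S b).
Proof. by have [_ Ssucc _ _] := hS; apply: Ssucc. Qed.

Lemma ord_zero_lt (a b : W) : ord_zero a -> ~ (b < a)%O.
Proof. by move=> az; rewrite ltNge az. Qed.

Lemma schreier_zero a : ord_zero a -> S a = [set A | (#|` A| <= 1)%N].
Proof. by have [Sz _ _ _] := hS; apply: Sz. Qed.

(** The index 0 stands for the integer 1, which allows a single block only, so the set descends
    through the ordinals down to [S_0]. *)
Lemma schreier_mem0 a A : S a A -> 0%N \in A -> A = [fset 0%N].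
Proof.
elim/(well_founded_ind W_wf): a A => a IH A.
case: (ordinalP a) => [_ ->|b [ba _] ->|_ _ lta _ _ ->] /=.
- move=> A1 A0; apply/esym/eqP; rewrite eqEfcard fsub1set A0 cardfs1 //.
- move=> step A0.
  have [E [D [SE -> _]]] := schreier_step_blocks (schreier0 b) step A0 (leqnn 0).
  by rewrite fsetU0 => AE; apply: IH ba _ _ A0; rewrite AE.
- by move=> [n [_ /IH]]; apply.
Qed.

(** At a limit, stage 1 is not the ordinal zero because the approximating sequence is strictly
    increasing, and it is open to every set avoiding the index 0. Sets containing 0 are
    singletons. *)
Lemma schreier_one_sub z a : ord_zero z -> ~ ord_zero a ->
  (schreier_step (S z) `<=` S a)%classic.
Proof.
move=> zz; elim/(well_founded_ind W_wf): a => a IH az.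
case: (ordinalP a) => [//|b [ba minb] ->|_ _ lta _ lt01 ->] A SA /=.
- have [bz|bz] := pselect (ord_zero b).
    by have -> : b = z by apply/le_anti; rewrite bz zz.
  by apply: sub_schreier_step; [apply: schreier0|apply: IH].
have a1z : ~ ord_zero (approx a 1) by move=> /ord_zero_lt; apply; exact: lt01.
have [A0|A0] := boolP (0%N \in A).
  exists 0%N; split=> //; suff -> : A = [fset 0%N] by apply: schreier1.
  have [b zb _] := ord_succ_exists (le_lt_trans (zz _) lt01).
  by apply: (@schreier_mem0 b) => //; rewrite (schreier_succ zb).
exists 1%N; split; last exact: IH.
by case=> //; rewrite (negPf A0).
Qed.

(* Limit ordinals are unravelled through their approximating sequences; for sets
   containing i only the first i + 1 terms of each of these matter. *)
Lemma schreier_unravel a i : ~ ord_zero a -> exists D : seq W,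
  [/\ D != [::], forall c, c \in D -> (c < a)%O,
   forall A, i \in A -> S a A -> exists2 c, c \in D & schreier_step (S c) A
   & forall c A, c \in D -> fset_ge i A -> schreier_step (S c) A -> S a A].
Proof.
elim/(well_founded_ind W_wf): a => a IH az.
case: (ordinalP a) => [//|b ba Sab|_ mono lta _ lt01 Sa].
  exists [:: b]; split=> //.
  - by move=> c; rewrite mem_seq1 => /eqP ->; case: ba.
  - by move=> A _; rewrite Sab; exists b; rewrite ?mem_seq1.
  - by move=> c A; rewrite mem_seq1 => /eqP -> _; rewrite Sab.
have stage n : (n <= i)%N -> exists D : seq W,
    [/\ D != [::], forall c, c \in D -> (c < a)%O,
    forall A, i \in A -> S (approx a n) A ->
      exists2 c, c \in D & schreier_step (S c) A
    & forall c A, c \in D -> fset_ge i A -> schreier_step (S c) A -> S a A].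
  (* A stage equal to zero cannot be unravelled further and is kept: [S_0] lies in
     [schreier_step S_0], which lies in [S a]. *)
  move=> ni; have [z|nz] := pselect (ord_zero (approx a n)).
    exists [:: approx a n]; split=> //.
    - by move=> c; rewrite mem_seq1 => /eqP ->.
    - move=> A _ SA; exists (approx a n); rewrite ?mem_seq1 //.
      by apply: sub_schreier_step SA; apply: schreier0.
    - move=> c A; rewrite mem_seq1 => /eqP -> _; exact: schreier_one_sub.
  have [D [D0 Da D1 D2]] := IH _ (lta n) nz; exists D; split=> //.
  - by move=> c /Da/lt_trans; apply.
  - move=> c A cD iA stepA; rewrite Sa; exists n; split; last exact: D2 stepA.
    by move=> k /iA; apply: leq_trans.
suff /(_ i (leqnn i)) [D [D0 Da D1 D2]] : forall j, (j <= i)%N ->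
    exists D : seq W, [/\ D != [::], forall c, c \in D -> (c < a)%O,
    forall n A, (n <= j)%N -> i \in A -> S (approx a n) A ->
      exists2 c, c \in D & schreier_step (S c) A
    & forall c A, c \in D -> fset_ge i A -> schreier_step (S c) A -> S a A].
  exists D; split=> // A iA; rewrite Sa => -[n [nA SA]].
  by apply: D1 SA => //; apply: nA.
elim=> [|j IHj] ji.
  have [D [D0 Da D1 D2]] := stage 0%N isT; exists D; split=> // n A.
  by rewrite leqn0 => /eqP ->; apply: D1.
have [D [D0 Da D1 D2]] := IHj (ltnW ji).
have [D' [D0' Da' D1' D2']] := stage j.+1 ji.
exists (D ++ D'); split.
- by case: (D) D0.
- by move=> c; rewrite mem_cat => /orP[/Da|/Da'].
- move=> n A; rewrite leq_eqVlt => /predU1P[->|nj] iA SA.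
    by have [c cD ?] := D1' _ iA SA; exists c; rewrite // mem_cat cD orbT.
  by have [c cD ?] := D1 _ _ nj iA SA; exists c; rewrite // mem_cat cD.
- by move=> c A; rewrite mem_cat => /orP[/D2|/D2']; apply.
Qed.

Lemma seq_max (D : seq W) : D != [::] ->
  exists2 c, c \in D & forall c', c' \in D -> (c' <= c)%O.
Proof.
elim: D => // c [|c1 D] IH _.
  by exists c; rewrite ?mem_head // => c'; rewrite mem_seq1 => /eqP ->.
have [//|m mD mmax] := IH; have [cm|mc] := leP c m.
  exists m; first by rewrite in_cons mD orbT.
  by move=> c'; rewrite in_cons => /predU1P[->|/mmax].
exists c; first exact: mem_head.
move=> c'; rewrite in_cons => /predU1P[->//|/mmax /le_trans]; apply.
exact: ltW.
Qed.

Section Wide.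
Variable r : nat -> nat -> Prop.
Hypothesis r_wide : wide r.

(** The bound on x drives the induction. At a successor, a member of [S a] containing some x <= N is
    made of N.+1 blocks of [S b], and unions of that many blocks already escape. At a limit, only
    the stages 0 to N are open to it, and all of them lie below one stage m. These stages join the
    families to be escaped, which is why the statement concerns a finite list [B] and not [a]
    alone. *)
Lemma schreier_escape a (B : seq W) : (forall b, b \in B -> (b <= a)%O) ->
  escapes r (S a) [set S b | b in [set` B]].
Proof.
elim/(well_founded_ind W_wf): a B => a IH B Ba N.
case: (ordinalP a) => [az Sa|b ba Sab|_ mono lta cof _ Sa].
- have [k [g [Nk Ng rkg]]] := r_wide N; exists [fset k], [fset g]; split.
  + by rewrite Sa /= cardfs1.
  + by move=> i /fset1P ->.
  + by move=> i /fset1P ->; exists k; rewrite ?fset11.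
  + by move=> i /fset1P ->.
  + move=> x _ xN [b /Ba ba <-].
    have -> : b = a by apply/le_anti; rewrite ba az.
    rewrite Sa /= cardfsU1 cardfs1 in_fset1.
    by rewrite (ltn_eqF (leq_ltn_trans xN Ng)).
- have ltb : (b < a)%O by case: ba.
  pose B' := b :: [seq c <- B | (c < a)%O].
  have B'b c : c \in B' -> (c <= b)%O.
    rewrite in_cons mem_filter => /predU1P[->//|/andP[ca _]].
    exact: ord_succ_le ba ca.
  have hB f : [set S b | b in [set` B']] f -> hereditary f.
    by move=> [c _ <-]; apply: schreier_hereditary.
  have [H [G [TH geH l geG esc]]] :=
    blocks_escape N.+1 hB (IH _ ltb _ B'b) N.
  exists H, G; split=> //.
    rewrite Sab; apply/schreier_stepP; exists N; split=> // i /geH.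
    exact: ltnW.
  move=> x _ xN [c /= cB <-] Sc; have := Ba _ cB; rewrite le_eqVlt.
  move=> /predU1P[ca|ca].
    apply: (esc x (blocks (S b) N.+1) xN).
      by exists (S b) => //; exists b => //=; rewrite mem_head.
    move: Sc; rewrite ca Sab => step.
    exact: schreier_step_blocks (schreier0 b) step (fset1U1 _ _) xN.
  apply: (esc x (blocks (S c) N.+1) xN).
    by exists (S c) => //; exists c => //=; rewrite in_cons mem_filter ca cB orbT.
  by apply: sub_blocks Sc; apply: schreier0.
have [m [Nm mB]] : exists m, (N <= m)%N /\
    forall c, c \in B -> (c < a)%O -> (c <= approx a m)%O.
  elim: (B) => [|c B' [m [Nm mB]]]; first by exists N.
  have [/cof [n cn]|ca] := boolP (c < a)%O; last first.
    exists m; split=> // c'; rewrite in_cons => /predU1P[->|/mB //].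
    by rewrite (negPf ca).
  exists (maxn m n); split; first by rewrite leq_max Nm.
  move=> c'; rewrite in_cons => /predU1P[-> _|/mB c'm /c'm /le_trans].
    by apply: le_trans cn _; apply: mono; rewrite leq_maxr.
  by apply; apply: mono; rewrite leq_maxl.
pose B' := [seq c <- B | (c < a)%O] ++ [seq approx a n | n <- iota 0 N.+1].
have B'm c : c \in B' -> (c <= approx a m)%O.
  rewrite mem_cat mem_filter => /orP[/andP[ca /mB]|]; first exact.
  move=> /mapP[n]; rewrite mem_iota add0n ltnS => /andP[_ nN] ->.
  by apply: mono; apply: leq_trans Nm.
have [H [G [TH geH l geG esc]]] := IH _ (lta m) _ B'm m.
exists H, G; split=> //.
- by rewrite Sa; exists m; split=> // i /geH; apply: ltnW.
- by move=> i /geH; apply: leq_trans.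
- by move=> i /geG; apply: leq_trans.
move=> x _ xN [c /= cB <-] Sc; have xm := leq_trans xN Nm.
have := Ba _ cB; rewrite le_eqVlt => /predU1P[ca|ca]; last first.
  apply: (esc x (S c) xm _ Sc); exists c => //=.
  by rewrite mem_cat mem_filter ca cB.
move: Sc; rewrite ca Sa => -[n [nx Sn]].
apply: (esc x (S (approx a n)) xm _ Sn); exists (approx a n) => //=.
rewrite mem_cat map_f ?orbT // mem_iota /= add0n ltnS.
by apply: leq_trans xN; apply: nx; apply: fset1U1.
Qed.

Lemma schreier_blocks_escape a (B : seq W) n :
  (forall b, b \in B -> (b <= a)%O) ->
  escapes r (blocks (S a) n) [set blocks (S b) n | b in [set` B]].
Proof.
move=> Ba N.
have hB f : [set S b | b in [set` B]] f -> hereditary f.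
  by move=> [c _ <-]; apply: schreier_hereditary.
have [H [G [TH geH l geG esc]]] := blocks_escape n hB (schreier_escape Ba) N.
exists H, G; split=> // x _ xN [b bB <-]; apply: esc => //.
by exists (S b) => //; exists b.
Qed.

(** A set starting at j may use at least one block more than a set starting at i. With c the largest
    ordinal unravelling [a] at i, [H] consists of i.+1 blocks of [S c] and j takes one more; i.+1
    blocks of any family unravelling [a] cannot hold i together with [G]. *)
Lemma schreier_shift a i j : ~ ord_zero a -> (i < j)%N ->
  exists H G, [/\ linked r H G, S a (j |` H) & ~ S a (i |` G)].
Proof.
move=> az ij; have [D [D0 Da D1 D2]] := schreier_unravel i az.
have [c cD cmax] := seq_max D0.
have [H [G [SH geH l geG esc]]] := schreier_blocks_escape i.+1 cmax j.
exists H, G; split=> //.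
  have jH : fset_ge j (j |` H).
    by move=> k /fset1UP[->//|/geH/ltnW].
  apply: (D2 c) => //; first by move=> k /jH; apply: leq_trans; apply: ltnW.
  apply/schreier_stepP; exists j; split=> //.
  apply: (@blocks_leq _ i.+2) => //; first exact: schreier0.
  exists [fset j], H; split=> //; first exact: schreier1.
  by move=> k l' /fset1P -> /geH.
move=> /D1 [|c' c'D step]; first exact: fset1U1.
apply: (esc i (blocks (S c') i.+1) (ltnW ij)); first by exists c'.
exact: schreier_step_blocks (schreier0 c') step (fset1U1 _ _) (leqnn i).
Qed.

End Wide.

(** * Relations along which membership in a Schreier family is transported *)

Section Transport.
Variables (a : W) (r : nat -> nat -> Prop).
Hypotheses (az : ~ ord_zero a) (r_wide : wide r).
Hypothesis r_transport : forall H G, S a H -> linked r H G -> S a G.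

(** If m came before i, [schreier_shift] would link a member of [S a] that contains i to a set
    outside [S a] that contains m. *)
Lemma transport_geq i m : r i m -> (i <= m)%N.
Proof.
move=> rim; rewrite leqNgt; apply/negP => mi.
have [H [G [l SH SG]]] := schreier_shift r_wide az mi.
apply: SG; apply: r_transport SH _; apply: linkedU => // g /fset1P ->.
by exists i; rewrite ?fset11.
Qed.

(** The singleton of i is in [S a], hence so is every finite set of images of i. Were the images
    unbounded, the relation ignoring its first argument would be wide and would yield such a set
    outside [S a]. *)
Lemma transport_bounded i : exists l, forall m, r i m -> (m <= l)%N.
Proof.
apply: contrapT => nl.
have unb l : exists2 m, (l < m)%N & r i m.
  apply: contrapT => nm; apply: nl; exists l => m rim.
  by rewrite leqNgt; apply/negP => lm; apply: nm; exists m.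
have [m _ rim] := unb 0%N.
have ri_wide : wide (fun _ => r i).
  by move=> N; have [m' Nm' rim'] := unb N; exists N.+1, m'.
have [|H [G [_ _ l _ esc]]] := @schreier_escape _ ri_wide a [:: a] _ m.
  by move=> b; rewrite mem_seq1 => /eqP ->.
apply: (esc m (S a)) => //; first by exists a => //=; rewrite mem_head.
apply: (r_transport (schreier1 a i)) => g /fset1UP[->|/l[_ _ rig]];
  by exists i; rewrite ?fset11.
Qed.

(* The transport from S c into itself of sets containing i goes down to a smaller
   c: when H exhausts i blocks of S e, transporting H0 together with H leaves a
   single block of S e for the image of H0. *)
Lemma transport_descent i c : r i i ->
  (forall H G, S c (i |` H) -> fset_ge i.+1 H -> linked r (i |` H) G -> S c G) ->
  forall m, r i m -> m = i.
Proof.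
move=> rii; elim/(well_founded_ind W_wf): c => c IH trans m rim.
have Sm : S c [fset i; m].
  apply: (trans fset0) => [||g]; first by rewrite fsetU0; apply: schreier1.
    by move=> k; rewrite in_fset0.
  by rewrite !inE => /orP[]/eqP ->; exists i; rewrite ?fset1U1.
have [cz|cnz] := pselect (ord_zero c).
  move: Sm; rewrite (schreier_zero cz) /= cardfs2.
  by have [->//|] := eqVneq i m.
have [i0|ipos] := posnP i.
  have : m \in [fset i; m] by rewrite !inE eqxx orbT.
  by rewrite (schreier_mem0 Sm) ?i0 ?fset1U1 // => /fset1P.
have [D [D0 Dc D1 D2]] := schreier_unravel i cnz.
have [e eD emax] := seq_max D0.
apply: (IH e (Dc _ eD)) rim => H0 G0 SH0 geH0 l0.
(* The successors, up to [e], of the members of [D]; they exclude an image unravelled through some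
   e' < e. The default [e] of [xget] is harmless, [e] being on the list anyway. *)
pose succs := [seq b <- [seq xget e [set b | ord_succ c' b] | c' <- D] | (b <= e)%O].
have [|H [G [SH geH l geG esc]]] := @schreier_blocks_escape _ r_wide e (e :: succs) i
    _ (maxn i (\max_(k <- H0 `|` G0) k)).
  by move=> b; rewrite in_cons mem_filter => /predU1P[->//|/andP[]].
set N := maxn _ _ in geH geG esc.
have iN : (i <= N)%N by rewrite leq_maxl.
have NP k : k \in H0 `|` G0 -> (k <= N)%N.
  by move=> kHG; rewrite leq_max leq_fset_max ?orbT.
(* Here i and [H0] form one block of [S e] and [H] fills i further ones: the full allowance of i.+1
   blocks at i. As i is linked to itself, the image still contains i and obeys the same
   allowance. *)
have ScG : S c ((i |` G0) `|` G).
  apply: (trans (H0 `|` H)).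
  - apply: (D2 e) => //.
      move=> k; rewrite !inE => /or3P[/eqP->//|/geH0/ltnW//|/geH].
      by move=> /ltnW; apply: leq_trans.
    apply/schreier_stepP; exists i; split.
      move=> k; rewrite !inE => /or3P[/eqP->//|/geH0/ltnW//|/geH].
      by move=> /ltnW; apply: leq_trans.
    exists (i |` H0), H; split=> //; last by rewrite fsetUA.
    move=> k k' kH0 /geH; apply: leq_trans; rewrite ltnS.
    by move: kH0 => /fset1UP[->//|kH0]; apply: NP; rewrite in_fsetU kH0.
  - move=> k; rewrite in_fsetU => /orP[/geH0//|/geH].
    by apply: leq_trans; rewrite ltnS.
  - rewrite fsetUA; apply: linkedU => // g /fset1UP[->|/l0//].
    by exists i; rewrite ?fset1U1.
have iG : i \in (i |` G0) `|` G by rewrite !inE eqxx.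
have [e' e'D step] := D1 _ iG ScG.
have := emax _ e'D; rewrite le_eqVlt => /predU1P[e'e|e'e]; last first.
  have [b eb be] := ord_succ_exists e'e.
  exfalso; apply: (esc i (blocks (S b) i) iN).
    exists b => //=; rewrite in_cons mem_filter be /=.
    apply/orP; right; apply/mapP; exists e' => //.
    case: xgetP => [b' _ /= eb'|/(_ b)//].
    apply/le_anti; have [? min] := eb; have [? min'] := eb'.
    by rewrite min // min'.
  have sb : (S b `<=` blocks (S b) i)%classic.
    by rewrite -(prednK ipos); apply: sub_blocks; apply: schreier0.
  apply: sb.
  rewrite (schreier_succ eb).
  apply: (schreier_step_hereditary (@schreier_hereditary e') step).
  by rewrite -fsetUA fsetUS // fsubsetUr.
rewrite {}e'e in step.
have [E [L [SE SL EL GE]]] := schreier_step_blocks (schreier0 e) step iG (leqnn i).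
(* A point y of [G0] outside the first block would push all of [G] into the remaining i blocks,
   against the choice of [G]. *)
apply: (schreier_hereditary SE); apply/fsubsetP => y yG0.
apply: contrapT => /negP yE.
have yL : y \in L.
  have : y \in E `|` L by rewrite -GE !inE yG0 !orbT.
  by rewrite in_fsetU (negPf yE).
have yN : (y <= N)%N by apply: NP; rewrite in_fsetU yG0 orbT.
apply: (esc y (blocks (S e) i) yN); first by exists e => //=; rewrite mem_head.
apply: (blocks_hereditary (@schreier_hereditary e) SL); apply/fsubsetP => z.
move=> /fset1UP[->//|zG].
have : z \in E `|` L by rewrite -GE !inE zG !orbT.
move=> /fsetUP[zE|//]; have := EL _ _ zE yL.
by rewrite ltnNge (leq_trans yN) // ltnW // geG.
Qed.

Lemma transport_diagonal i m : r i i -> r i m -> m = i.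
Proof.
move=> rii; apply: (transport_descent (c := a)) => // H G SH _.
exact: r_transport.
Qed.

End Transport.
End Transfinite.

End SchreierFamilies.

Local Open Scope ring_scope.

(** * Scalars *)

Section Scalars.
Variables (R : realType) (s : scalar_kind).
Local Notation K := (scalar_field R s).
Implicit Types (x y z : K) (r t : R).

Definition real_scalar r : K :=
  match s return scalar_field R s with
  | RealScalars => r | ComplexScalars => real_complex R r
  end.

Definition modulus (z : K) : R := realpart `|z|.

Lemma realpartD x y : realpart (x + y) = realpart x + realpart y.
Proof. by case: s x y => [//|] [a b] [c d]. Qed.

Lemma realpartN x : realpart (- x) = - realpart x.
Proof. by case: s x => [//|] [a b]. Qed.

Lemma realpartB x y : realpart (x - y) = realpart x - realpart y.
Proof. by rewrite realpartD realpartN. Qed.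

Lemma realpart0 : realpart (0 : K) = 0.
Proof. by case: s. Qed.

Lemma realpart1 : realpart (1 : K) = 1.
Proof. by case: s. Qed.

Lemma realpart_sum (I : Type) (A : seq I) (u : I -> K) :
  realpart (\sum_(i <- A) u i) = \sum_(i <- A) realpart (u i).
Proof. exact: (big_morph _ realpartD realpart0). Qed.

Lemma real_scalarK r : realpart (real_scalar r) = r.
Proof. by rewrite /real_scalar; case: s. Qed.

Lemma real_scalar0 : real_scalar 0 = 0.
Proof. by rewrite /real_scalar; case: s. Qed.

Lemma real_scalar1 : real_scalar 1 = 1.
Proof. by rewrite /real_scalar; case: s. Qed.

Lemma real_scalarD r t : real_scalar (r + t) = real_scalar r + real_scalar t.
Proof. by rewrite /real_scalar; case: s; rewrite //= rmorphD. Qed.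

Lemma real_scalar_sum (I : Type) (A : seq I) (r : I -> R) :
  real_scalar (\sum_(i <- A) r i) = \sum_(i <- A) real_scalar (r i).
Proof. exact: (big_morph _ real_scalarD real_scalar0). Qed.

Lemma real_scalarM r t : real_scalar (r * t) = real_scalar r * real_scalar t.
Proof. by rewrite /real_scalar; case: s; rewrite //= rmorphM. Qed.

Lemma realpartZ r z : realpart (real_scalar r * z) = r * realpart z.
Proof.
rewrite /real_scalar; case: s z => [//|[a b]] /=.
by simpc.
Qed.

Lemma ge0_realpartK z : 0 <= z -> real_scalar (realpart z) = z.
Proof.
rewrite /real_scalar; case: s z => [//|z] z0 /=.
by apply: RRe_real; apply: ger0_real.
Qed.

Lemma realpart_le x y : x <= y -> realpart x <= realpart y.
Proof. by case: s x y => [//|x y]; rewrite /= lecE => /andP[]. Qed.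

Lemma real_scalar_lt r t : (real_scalar r < real_scalar t) = (r < t).
Proof. by rewrite /real_scalar; case: s => //=; rewrite ltcR. Qed.

Lemma modulusE z : `|z| = real_scalar (modulus z).
Proof. by rewrite ge0_realpartK. Qed.

Lemma modulus_ge0 z : 0 <= modulus z.
Proof. by rewrite -realpart0; apply: realpart_le. Qed.

Lemma modulus0 : modulus 0 = 0.
Proof. by rewrite /modulus normr0 realpart0. Qed.

Lemma modulus1 : modulus 1 = 1.
Proof. by rewrite /modulus normr1 realpart1. Qed.

Lemma modulusN z : modulus (- z) = modulus z.
Proof. by rewrite /modulus normrN. Qed.

Lemma modulusBC x y : modulus (x - y) = modulus (y - x).
Proof. by rewrite -modulusN opprB. Qed.

Lemma modulus_eq0 z : (modulus z == 0) = (z == 0).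
Proof.
apply/eqP/eqP => [z0|->]; last exact: modulus0.
by apply/eqP; rewrite -normr_eq0 modulusE z0 real_scalar0.
Qed.

Lemma modulus_gt0 z : (0 < modulus z) = (z != 0).
Proof. by rewrite lt0r modulus_eq0 modulus_ge0 andbT. Qed.

Lemma modulusM x y : modulus (x * y) = modulus x * modulus y.
Proof. by rewrite /modulus normrM [X in X * _]modulusE realpartZ. Qed.

Lemma modulusV x : modulus x^-1 = (modulus x)^-1.
Proof.
have [->|x0] := eqVneq x 0; first by rewrite invr0 modulus0 invr0.
have mx0 : modulus x != 0 by rewrite modulus_eq0.
by apply: (mulfI mx0); rewrite -modulusM divff // modulus1 divff.
Qed.

Lemma modulusD x y : modulus (x + y) <= modulus x + modulus y.
Proof. by rewrite /modulus -realpartD; apply: realpart_le; apply: ler_normD. Qed.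

Lemma modulus_real_scalar r : modulus (real_scalar r) = `|r|.
Proof.
rewrite /modulus /real_scalar; case: s => //=.
by rewrite expr0n /= addr0 sqrtr_sqr.
Qed.

Lemma realpart_le_modulus z : realpart z <= modulus z.
Proof.
rewrite /modulus; case: s z => [|[a b]]; first exact: ler_norm.
rewrite /= (le_trans (ler_norm _)) // -sqrtr_sqr ler_wsqrtr //.
by rewrite lerDl sqr_ge0.
Qed.

Lemma modulus_sqrB x y :
  modulus (x - y) ^+ 2 + modulus (x + y) ^+ 2 =
  2 * (modulus x ^+ 2 + modulus y ^+ 2).
Proof.
rewrite /modulus; case: s x y => [x y|[a b] [c d]].
  by rewrite /= !real_normK ?num_real //; ring.
by rewrite /= !sqr_sqrtr ?addr_ge0 ?sqr_ge0 //; ring.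
Qed.

(** Separates the error in modulus from the error in phase, since Young's defect controls each of
    them. *)
Lemma modulus_sqrB1 z :
  modulus (z - 1) ^+ 2 = (modulus z - 1) ^+ 2 + 2 * (modulus z - realpart z).
Proof.
have -> : (modulus z - 1) ^+ 2 + 2 * (modulus z - realpart z) =
  modulus z ^+ 2 - 2 * realpart z + 1 by ring.
rewrite /modulus; case: s z => [z|[a b]].
  by rewrite /= !real_normK ?num_real //; ring.
by rewrite /= !sqr_sqrtr ?addr_ge0 ?sqr_ge0 //; ring.
Qed.

Lemma phase_exists z : exists2 w : K, modulus w = 1 & w * z = real_scalar (modulus z).
Proof.
have [->|z0] := eqVneq z 0.
  by exists 1; rewrite ?modulus1 // mul1r modulus0 real_scalar0.
exists (real_scalar (modulus z) / z); last by rewrite divfK.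
rewrite modulusM modulus_real_scalar modulusV ger0_norm ?modulus_ge0 //.
by rewrite divff // modulus_eq0.
Qed.

Lemma modulus_sum (I : Type) (A : seq I) (u : I -> K) :
  modulus (\sum_(i <- A) u i) <= \sum_(i <- A) modulus (u i).
Proof.
elim: A => [|i A IH]; first by rewrite !big_nil modulus0.
by rewrite !big_cons (le_trans (modulusD _ _)) // lerD2l.
Qed.

End Scalars.

(** * Power inequalities *)

Section Powers.
Variable R : realType.
Implicit Types (p q r t x y : R).

Lemma one_powR r : 1 `^ r = 1 :> R.
Proof. by rewrite powR1. Qed.

Lemma powR_le r x y : 0 <= r -> 0 <= x -> x <= y -> x `^ r <= y `^ r.
Proof.
by move=> r0 x0 xy; apply: ge0_ler_powR; rewrite ?nnegrE // (le_trans x0).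
Qed.

Lemma powR_lt r x y : 0 < r -> 0 <= x -> x < y -> x `^ r < y `^ r.
Proof.
by move=> r0 x0 xy; apply: gt0_ltr_powR; rewrite ?nnegrE // (le_trans x0) // ltW.
Qed.

Lemma powR_le_inv r x y : 0 < r -> 0 <= x -> 0 <= y -> x `^ r <= y `^ r -> x <= y.
Proof.
move=> r0 x0 y0 xy; rewrite leNgt; apply/negP => /(powR_lt r0 y0).
by rewrite ltNge xy.
Qed.

Lemma powRK r x : r != 0 -> 0 <= x -> (x `^ r) `^ r^-1 = x.
Proof. by move=> r0 x0; rewrite -powRrM divff // powRr1. Qed.

Lemma powRVK r x : r != 0 -> 0 <= x -> (x `^ r^-1) `^ r = x.
Proof. by move=> r0 x0; rewrite -powRrM mulVf // powRr1. Qed.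

Lemma powR_convex r t x y : 1 <= r -> 0 <= t <= 1 -> 0 <= x -> 0 <= y ->
  ((1 - t) * x + t * y) `^ r <= (1 - t) * x `^ r + t * y `^ r.
Proof.
move=> r1 /andP[t0 t1] x0 y0.
have := @convex_powR R r r1 (Itv01 t0 t1) y x.
rewrite !inE /= !in_itv /= !andbT => /(_ y0 x0).
by rewrite !convRE /= [X in X `^ r]addrC [leRHS]addrC.
Qed.

Lemma powR_half r x y : 1 <= r -> 0 <= x -> 0 <= y ->
  2 * ((x + y) / 2) `^ r <= x `^ r + y `^ r.
Proof.
move=> r1 x0 y0; have := @powR_convex r 2^-1 x y r1.
have -> : (1 - 2^-1) * x + 2^-1 * y = (x + y) / 2 by field.
have -> : (1 - 2^-1) * x `^ r + 2^-1 * y `^ r = (x `^ r + y `^ r) / 2 by field.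
have h : 0 <= (2^-1 : R) <= 1 by lra.
by move=> /(_ h x0 y0); lra.
Qed.

(** Concavity follows from convexity for the exponent 1/r, applied to the r-th powers. *)
Lemma powR_half_le1 r x y : 0 < r <= 1 -> 0 <= x -> 0 <= y ->
  x `^ r + y `^ r <= 2 * ((x + y) / 2) `^ r.
Proof.
move=> /andP[r0 r1] x0 y0; have rV1 : 1 <= r^-1 by rewrite invf_ge1.
have rn0 : r != 0 by rewrite gt_eqF.
have := @powR_half r^-1 (x `^ r) (y `^ r) rV1 (powR_ge0 _ _) (powR_ge0 _ _).
rewrite !powRK // => h.
suff : (x `^ r + y `^ r) / 2 <= ((x + y) / 2) `^ r by lra.
have h0 : 0 <= (x `^ r + y `^ r) / 2 by rewrite divr_ge0 // addr_ge0 ?powR_ge0.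
have rV0 : 0 < r^-1 by rewrite invr_gt0.
apply: (powR_le_inv rV0 h0); first exact: powR_ge0.
by rewrite powRK //; [lra | rewrite divr_ge0 // addr_ge0].
Qed.

Lemma powR_super r x y : 1 < r -> 0 < x -> 0 < y ->
  x `^ r + y `^ r < (x + y) `^ r.
Proof.
move=> r1 x0 y0; have r0 : 0 < r by lra.
have e z : 0 < z -> z `^ r = z * z `^ (r - 1).
  by move=> z0; rewrite mulr_powRB1 // ltW.
have xy0 : 0 < x + y by rewrite addr_gt0.
rewrite !e // mulrDl ltrD // ltr_pM2l // powR_lt ?subr_gt0 ?ltW //; lra.
Qed.

Lemma powR_sub r x y : 0 < r < 1 -> 0 < x -> 0 < y ->
  (x + y) `^ r < x `^ r + y `^ r.
Proof.
move=> /andP[r0 r1] x0 y0.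
have e z : 0 < z -> z `^ r = z * z `^ (r - 1).
  by move=> z0; rewrite mulr_powRB1 // ltW.
have xy0 : 0 < x + y by rewrite addr_gt0.
have lt z : 0 < z -> z < x + y -> (x + y) `^ (r - 1) < z `^ (r - 1).
  move=> z0 zxy; rewrite -opprB !powRN ltf_pV2 ?posrE ?powR_gt0 //.
  by apply: powR_lt => //; [rewrite subr_gt0|apply: ltW].
by rewrite !e // mulrDl ltrD // ltr_pM2l // lt //; lra.
Qed.

End Powers.

(** * Young's inequality with a quantitative equality case *)

Section Conjugate.
Variables (R : realType) (p q : R).
Hypotheses (p0 : 0 < p) (q0 : 0 < q) (pq : p^-1 + q^-1 = 1).
Implicit Types (r t x y : R).

Let p1 : 1 < p.
Proof.
have : p^-1 < 1 by rewrite -pq ltrDl invr_gt0.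
by rewrite invf_lt1.
Qed.

(** Weighted arithmetic and geometric means of x^p and 1, with weights 1/p and 1/q: the bound ln y
    <= y - 1 is applied to both numbers divided by their mean m, and is strict at the first because
    x differs from 1. *)
Lemma strict_young x : 0 <= x -> x != 1 -> x < q^-1 + x `^ p / p.
Proof.
move=> x0 x1; have [->|xn0] := eqVneq x 0.
  by rewrite powR0 ?gt_eqF // mul0r addr0 invr_gt0.
have xgt0 : 0 < x by rewrite lt0r xn0.
pose a := x `^ p; have a0 : 0 < a by apply: powR_gt0.
have pV0 : 0 < p^-1 by rewrite invr_gt0.
have qV0 : 0 < q^-1 by rewrite invr_gt0.
pose m := q^-1 + a / p; have m0 : 0 < m by rewrite addr_gt0 // mulr_gt0.
have lnle y : 0 < y -> ln y <= y - 1.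
  by move=> y0; rewrite -ler_expR lnK ?posrE // (le_trans _ (expR_ge1Dx _)) //; lra.
have lnlt y : 0 < y -> y != 1 -> ln y < y - 1.
  move=> y0 y1; rewrite -ltr_expR lnK ?posrE //.
  have : y - 1 != 0 by rewrite subr_eq0.
  by move=> /expR_gt1Dx; rewrite addrC subrK.
have am1 : a / m != 1.
  apply/negP => /eqP/(canRL (divfK (lt0r_neq0 m0))); rewrite mul1r /m => am.
  have : a * q^-1 = q^-1.
    have -> : a * q^-1 = a * (p^-1 + q^-1) - a / p by ring.
    by rewrite pq mulr1 [X in X - _]am addrK.
  rewrite -[RHS]mul1r => /(mulIf (lt0r_neq0 qV0)) a1.
  move/eqP: x1; apply; have := @powRK R p x (lt0r_neq0 p0) x0.
  by rewrite -/a a1 powR1.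
have h1 := lnlt (a / m) (divr_gt0 a0 m0) am1.
have mV0 : 0 < m^-1 by rewrite invr_gt0.
have h2 := lnle m^-1 mV0.
rewrite -ltr_ln ?posrE //.
have e1 : ln (a / m) = p * ln x - ln m by rewrite ln_div ?posrE // ln_powR.
have e2 : ln m^-1 = - ln m by rewrite lnV ?posrE.
have k1 : p^-1 * ln (a / m) < p^-1 * (a / m - 1) by rewrite ltr_pM2l.
have k2 : q^-1 * ln m^-1 <= q^-1 * (m^-1 - 1) by rewrite ler_pM2l.
have k3 : p^-1 * (a / m - 1) + q^-1 * (m^-1 - 1) = 0.
  have -> : p^-1 * (a / m - 1) + q^-1 * (m^-1 - 1) =
      (q^-1 + a / p) / m - (p^-1 + q^-1) by ring.
  by rewrite pq -/m divff ?subrr // gt_eqF.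
have k4 : p^-1 * ln (a / m) + q^-1 * ln m^-1 = ln x - ln m.
  rewrite e1 e2 mulrBr mulrA mulVf ?gt_eqF // mul1r mulrN -addrA -opprD.
  by rewrite -mulrDl pq mul1r.
lra.
Qed.

(** The defect is convex and vanishes at 1, so beyond distance e it is at least the smaller of its
    values at 1 - e and 1 + e, both positive by strictness. *)
Lemma young_modulus_real e : 0 < e -> exists2 dl, 0 < dl & forall x, 0 <= x ->
  q^-1 + x `^ p / p - x <= dl -> `|x - 1| <= e.
Proof.
wlog e1 : e / e < 1.
  move=> wl e0; have [/wl/(_ e0)//|e1] := ltP e 1.
  have [||dl dl0 h] := wl 2^-1; [lra|lra|exists dl => // x x0 /(h _ x0)].
  lra.
move=> e0; pose th x := q^-1 + x `^ p / p - x.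
have th0 x : 0 <= x -> x != 1 -> 0 < th x.
  by move=> x0 x1; have := strict_young x0 x1; rewrite /th; lra.
have conv t x : 0 <= t <= 1 -> 0 <= x -> th (1 + t * (x - 1)) <= t * th x.
  move=> t01 x0; have := @powR_convex R p t 1 x (ltW p1) t01 ler01 x0.
  rewrite powR1 mulr1.
  have -> : 1 - t + t * x = 1 + t * (x - 1) by ring.
  rewrite /th => h.
  have pV0 : 0 < p^-1 by rewrite invr_gt0.
  have : (1 + t * (x - 1)) `^ p / p <= (1 - t + t * x `^ p) / p by rewrite ler_pM2r.
  have -> : t * (q^-1 + x `^ p / p - x) = (1 - t + t * x `^ p) / p + q^-1 -
      (1 + t * (x - 1)) + (1 - t) * (1 - (p^-1 + q^-1)) by ring.
  by rewrite pq subrr mulr0 addr0; lra.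
have thx x : 0 <= x -> 0 <= th x.
  move=> x0; have [->|/(th0 _ x0)/ltW//] := eqVneq x 1.
  by rewrite /th powR1 mul1r; have := pq; lra.
have far c x : 0 <= x -> `|c| = e -> 0 <= c * (x - 1) -> e < `|x - 1| -> th (1 + c) <= th x.
  move=> x0 ce cx ex.
  have x1 : 0 < `|x - 1| by apply: lt_trans ex.
  have ct : c = e / `|x - 1| * (x - 1).
    have : c * `|x - 1| = e * (x - 1).
      rewrite -ce; have [c0|c0] := leP 0 c.
        have x10 : 0 <= x - 1.
          have : 0 < c by rewrite lt0r c0 -normr_eq0 ce gt_eqF.
          by move=> /pmulr_rge0 <-.
        by rewrite !ger0_norm.
      have x10 : x - 1 <= 0 by move: cx; rewrite nmulr_rge0.
      by rewrite ler0_norm // ltr0_norm //; ring.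
    by move=> h; rewrite mulrAC -h mulfK // gt_eqF.
  have t01 : 0 <= e / `|x - 1| <= 1.
    by rewrite divr_ge0 ?(ltW e0) //= ler_pdivrMr // mul1r ltW.
  rewrite ct; apply: le_trans (conv _ _ t01 x0) _.
  by rewrite ler_piMl ?thx //; case/andP: t01.
pose dl := Num.min (th (1 + e)) (th (1 - e)).
have dl0 : 0 < dl.
  by rewrite lt_min !th0 //; lra.
exists (dl / 2); first by lra.
move=> x x0 thle; rewrite leNgt; apply/negP => ex.
suff : dl <= th x by rewrite /th in thle *; lra.
rewrite ge_min; apply/orP; have [x1|x1] := leP 0 (x - 1).
  left; apply: far => //; first by rewrite ger0_norm // ltW.
  by rewrite mulr_ge0 // ltW.
right; apply: far => //; first by rewrite normrN ger0_norm // ltW.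
by rewrite mulr_le0 // ?oppr_le0 ltW.
Qed.

End Conjugate.

Section YoungDefect.
Variables (R : realType) (s : scalar_kind).
Local Notation K := (scalar_field R s).
Local Notation modulus := (@modulus R s).

(* At [a = 0] this is [0 / 0 = 0] when [q != 0]. *)
Definition dual_scalar (q : R) (a : K) : K := real_scalar s (modulus a `^ q) / a.

Variables (p q : R).
Hypotheses (p0 : 0 < p) (q0 : 0 < q) (pq : p^-1 + q^-1 = 1).

Let qE : q = p * (q - 1).
Proof.
have : q * p * (p^-1 + q^-1) = q * p by rewrite pq mulr1.
rewrite mulrDr mulfK ?gt_eqF // mulrAC divff ?gt_eqF // mul1r => h.
by rewrite mulrBr mulr1 [p * q]mulrC -h; ring.
Qed.

Let pn0 : p != 0. Proof. by rewrite gt_eqF. Qed.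
Let qn0 : q != 0. Proof. by rewrite gt_eqF. Qed.

Lemma mul_dual_scalar a : a * dual_scalar q a = real_scalar s (modulus a `^ q).
Proof.
have [->|a0] := eqVneq a 0; last by rewrite mulrC divfK.
by rewrite mul0r modulus0 powR0 ?qn0 // real_scalar0.
Qed.

Lemma modulus_dual_scalar a : modulus (dual_scalar q a) `^ p = modulus a `^ q.
Proof.
rewrite modulusM modulus_real_scalar modulusV ger0_norm ?powR_ge0 //.
have [->|a0] := eqVneq a 0.
  by rewrite modulus0 powR0 // mul0r !powR0.
have m0 : modulus a != 0 by rewrite modulus_eq0.
rewrite -[(modulus a)^-1]powR_inv1 ?modulus_ge0 // -powRD ?m0 ?implybT //.
by rewrite -powRrM mulrC -qE.
Qed.

Lemma dual_scalar_neq0 a : a != 0 -> dual_scalar q a != 0.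
Proof.
move=> a0; apply/negP => /eqP b0; have := modulus_dual_scalar a.
rewrite b0 modulus0 powR0 // => A0.
have : 0 < modulus a `^ q by rewrite powR_gt0 // modulus_gt0.
by rewrite -A0 ltxx.
Qed.

Lemma dual_scalarK a : dual_scalar p (dual_scalar q a) = a.
Proof.
rewrite {1}/dual_scalar modulus_dual_scalar.
have [->|a0] := eqVneq a 0; first by rewrite modulus0 powR0 // real_scalar0 mul0r.
by rewrite -mul_dual_scalar mulfK // dual_scalar_neq0.
Qed.

Lemma young a z : realpart (a * z) <= modulus a `^ q / q + modulus z `^ p / p.
Proof.
rewrite (le_trans (realpart_le_modulus _)) // modulusM.
by apply: conjugate_powR; rewrite ?modulus_ge0 // addrC.
Qed.

(** With z = b w and b = [dual_scalar q a], the defect is |a|^q times the sum of the real defect at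
    |w| and of |w| - Re w. Both are nonnegative, so both are small. *)
Lemma young_modulus a e : 0 < e -> exists2 dl, 0 < dl & forall z : K,
  modulus a `^ q / q + modulus z `^ p / p - realpart (a * z) <= dl ->
  modulus (z - dual_scalar q a) <= e.
Proof.
move=> e0; have [->|a0] := eqVneq a 0.
  exists (e `^ p / p); first by rewrite divr_gt0 // powR_gt0.
  move=> z; rewrite /dual_scalar modulus0 powR0 // !mul0r real_scalar0 !mul0r.
  rewrite realpart0 add0r !subr0 ler_pM2r ?invr_gt0 //.
  by apply: powR_le_inv; rewrite ?modulus_ge0 // ltW.
pose A := modulus a `^ q.
have A0 : 0 < A by rewrite powR_gt0 // modulus_gt0.
pose b := dual_scalar q a.
have b0 : b != 0 by apply: dual_scalar_neq0.
have mb0 : 0 < modulus b by rewrite modulus_gt0.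
(* Chosen so that 2 e1 |b| = e: a modulus error e1 and a phase error e1^2 give |w - 1|^2 <= e1^2 + 2
   e1^2 <= (2 e1)^2. *)
pose e1 := e / (2 * modulus b); have e10 : 0 < e1 by rewrite divr_gt0 // mulr_gt0.
have [dl dl0 dlP] := young_modulus_real p0 q0 pq e10.
pose dl' := Num.min dl (e1 ^+ 2).
have dl'0 : 0 < dl' by rewrite lt_min dl0 exprn_gt0.
exists (A * dl'); first by rewrite mulr_gt0.
move=> z; pose w := z / b; have zE : z = b * w by rewrite mulrC divfK.
rewrite zE mulrA mul_dual_scalar realpartZ modulusM powRM ?modulus_ge0 //.
rewrite modulus_dual_scalar -/A.
have -> : A / q + A * modulus w `^ p / p - A * realpart w =
  A * (q^-1 + modulus w `^ p / p - realpart w) by ring.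
rewrite ler_pM2l // => h.
have re := realpart_le_modulus w; have m0 := modulus_ge0 w.
have [d1 d2] : dl' <= dl /\ dl' <= e1 ^+ 2 by rewrite /dl' !ge_min !lexx orbT.
have th0 : 0 <= q^-1 + modulus w `^ p / p - modulus w.
  have [->|/(strict_young p0 q0 pq m0)] := eqVneq (modulus w) 1; last by lra.
  by rewrite powR1 mul1r; have := pq; lra.
have w1 : `|modulus w - 1| <= e1 by apply: dlP => //; lra.
have w2 : (modulus w - 1) ^+ 2 <= e1 ^+ 2.
  by rewrite -[X in X <= _]real_normK ?num_real // lerXn2r // ?nnegrE // ltW.
have w3 : modulus (w - 1) ^+ 2 <= (2 * e1) ^+ 2.
  rewrite modulus_sqrB1 exprMn; lra.
have w4 : modulus (w - 1) <= 2 * e1.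
  by rewrite -ler_sqr ?nnegrE ?modulus_ge0 // ltW // mulr_gt0.
have -> : b * w - b = b * (w - 1) by ring.
rewrite modulusM (le_trans (ler_wpM2l (ltW mb0) w4)) // /e1.
by have -> : modulus b * (2 * (e / (2 * modulus b))) = e by field; rewrite gt_eqF.
Qed.

End YoungDefect.

Section Clarkson.
Variables (R : realType) (s : scalar_kind) (q : R).
Local Notation K := (scalar_field R s).
Implicit Types a b : K.

Let sq_pow a : modulus a `^ q = (modulus a ^+ 2) `^ (q / 2).
Proof.
by rewrite -powR_mulrn ?modulus_ge0 // -powRrM mulrC divfK // pnatr_eq0.
Qed.

Let parallelogram a b : (modulus (a + b) ^+ 2 + modulus (a - b) ^+ 2) / 2 =
  modulus a ^+ 2 + modulus b ^+ 2.
Proof. by rewrite addrC modulus_sqrB; field. Qed.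

(** Midpoint convexity of the power q/2 at |a + b|^2 and |a - b|^2, with the parallelogram law,
    gives the lower bound 2 (|a|^2 + |b|^2)^(q/2). Strictness is that of superadditivity at two
    positive terms. *)
Lemma clarkson_gt2_lt a b : 2 < q -> a != 0 -> b != 0 ->
  2 * (modulus a `^ q + modulus b `^ q) < modulus (a + b) `^ q + modulus (a - b) `^ q.
Proof.
move=> q2 a0 b0; rewrite !sq_pow.
have r1 : 1 <= q / 2 by lra.
have := powR_half r1 (sqr_ge0 (modulus (a + b))) (sqr_ge0 (modulus (a - b))).
rewrite parallelogram; apply: lt_le_trans.
rewrite ltr_pM2l ?ltr0n // powR_super ?exprn_gt0 ?modulus_gt0 //; lra.
Qed.

Lemma clarkson_gt2 a b : 2 < q ->
  2 * (modulus a `^ q + modulus b `^ q) <= modulus (a + b) `^ q + modulus (a - b) `^ q.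
Proof.
move=> q2; have [->|a0] := eqVneq a 0.
  by rewrite add0r sub0r modulusN modulus0 powR0 ?add0r; [lra|rewrite gt_eqF //; lra].
have [->|b0] := eqVneq b 0.
  by rewrite addr0 subr0 modulus0 powR0 ?addr0; [lra|rewrite gt_eqF //; lra].
exact: ltW (clarkson_gt2_lt q2 a0 b0).
Qed.

Lemma clarkson_lt2_lt a b : 0 < q < 2 -> a != 0 -> b != 0 ->
  modulus (a + b) `^ q + modulus (a - b) `^ q < 2 * (modulus a `^ q + modulus b `^ q).
Proof.
move=> /andP[q0 q2] a0 b0; rewrite !sq_pow.
have r0 : 0 < q / 2 <= 1 by lra.
have := powR_half_le1 r0 (sqr_ge0 (modulus (a + b))) (sqr_ge0 (modulus (a - b))).
rewrite parallelogram => /le_lt_trans; apply.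
rewrite ltr_pM2l ?ltr0n // powR_sub ?exprn_gt0 ?modulus_gt0 //; lra.
Qed.

Lemma clarkson_lt2 a b : 0 < q < 2 ->
  modulus (a + b) `^ q + modulus (a - b) `^ q <= 2 * (modulus a `^ q + modulus b `^ q).
Proof.
move=> q02; have [q0 q2] := andP q02; have [->|a0] := eqVneq a 0.
  by rewrite add0r sub0r modulusN modulus0 powR0 ?add0r; [lra|rewrite gt_eqF //; lra].
have [->|b0] := eqVneq b 0.
  by rewrite addr0 subr0 modulus0 powR0 ?addr0; [lra|rewrite gt_eqF //; lra].
exact: ltW (clarkson_lt2_lt q02 a0 b0).
Qed.

End Clarkson.

(** * Norms, dual norms and isometries *)

Section NormAndDual.
Variables (R : realType) (s : scalar_kind).
Local Notation K := (scalar_field R s).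
Variable X : normedModType K.
Implicit Types (x y : X) (f g : dual_space X).

Lemma vnormE x : `|x| = real_scalar s (vnorm x).
Proof. by rewrite ge0_realpartK. Qed.

Lemma vnorm_ge0 x : 0 <= vnorm x.
Proof. by rewrite -(realpart0 R s); apply: realpart_le. Qed.

Lemma vnorm0 : vnorm (0 : X) = 0.
Proof. by rewrite /vnorm normr0 realpart0. Qed.

Lemma vnorm0_eq0 x : vnorm x = 0 -> x = 0.
Proof. by move=> x0; apply/normr0_eq0; rewrite vnormE x0 real_scalar0. Qed.

Lemma vnormD x y : vnorm (x + y) <= vnorm x + vnorm y.
Proof. by rewrite /vnorm -realpartD; apply: realpart_le; apply: ler_normD. Qed.

Lemma vnormN x : vnorm (- x) = vnorm x.
Proof. by rewrite /vnorm normrN. Qed.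

Lemma vnormBC x y : vnorm (x - y) = vnorm (y - x).
Proof. by rewrite -vnormN opprB. Qed.

Lemma vnormZ (a : K) x : vnorm (a *: x) = modulus a * vnorm x.
Proof. by rewrite /vnorm normrZ [X in X * _]modulusE realpartZ. Qed.

Lemma dualD f g x : (f + g) x = f x + g x. Proof. by []. Qed.
Lemma dualB f g x : (f - g) x = f x - g x. Proof. by []. Qed.
Lemma dualZ (a : K) f x : (a *: f) x = a * f x. Proof. by []. Qed.
Lemma dual0 x : (0 : dual_space X) x = 0. Proof. by []. Qed.

Lemma dual_sum (I : Type) (A : seq I) (h : I -> dual_space X) x :
  (\sum_(i <- A) h i) x = \sum_(i <- A) h i x.
Proof. by elim/big_ind2: _ => // f y g z <- <-. Qed.

Lemma dual_ext f g : (forall x, f x = g x) -> f = g.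
Proof. by move=> fg; apply/val_inj/funext. Qed.

Lemma dual_linear f : linear f.
Proof. by have /asboolP[] := dual_valP f. Qed.

Lemma dual_add f x y : f (x + y) = f x + f y.
Proof. by have := dual_linear f 1 x y; rewrite !scale1r. Qed.

Lemma dual_at0 f : f 0 = 0.
Proof. by apply: (addrI (f 0)); rewrite -dual_add !addr0. Qed.

Lemma dual_scale f (a : K) x : f (a *: x) = a * f x.
Proof. by have := dual_linear f a x 0; rewrite !addr0 dual_at0 addr0. Qed.

Lemma dual_opp f x : f (- x) = - f x.
Proof. by rewrite -scaleN1r dual_scale mulN1r. Qed.

Lemma dual_sub f x y : f (x - y) = f x - f y.
Proof. by rewrite dual_add dual_opp. Qed.

Lemma dual_at_sum (I : Type) (A : seq I) f (y : I -> X) :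
  f (\sum_(i <- A) y i) = \sum_(i <- A) f (y i).
Proof. exact: (big_morph _ (dual_add f) (dual_at0 f)). Qed.

Lemma dual_bounded f : exists2 C, 0 < C & forall x, modulus (f x) <= C * vnorm x.
Proof.
have /asboolP[_ /(_ 0) /cvgrPdist_lt /(_ 1 ltr01)] := dual_valP f.
move=> /nbhs_ballP[dl /= dl0 sub].
pose r := realpart dl; have dlE : dl = real_scalar s r by rewrite ge0_realpartK ?ltW.
have r0 : 0 < r by rewrite -(real_scalar_lt s) real_scalar0 -dlE.
exists (2 / r) => [|x]; first by rewrite divr_gt0.
have [x0|xn0] := eqVneq (vnorm x) 0.
  by rewrite (vnorm0_eq0 x0) dual_at0 modulus0 vnorm0 mulr0.
have vx0 : 0 < vnorm x by rewrite lt0r xn0 vnorm_ge0.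
pose c := r / (2 * vnorm x); have c0 : 0 < c by rewrite divr_gt0 // mulr_gt0.
have /sub : ball 0 dl (real_scalar s c *: x).
  rewrite -ball_normE /= sub0r normrN vnormE vnormZ modulus_real_scalar.
  rewrite ger0_norm ?ltW // dlE real_scalar_lt /c.
  have -> : r / (2 * vnorm x) * vnorm x = r / 2 by field.
  lra.
rewrite /= dual_at0 sub0r normrN dual_scale modulusE -(real_scalar1 R s).
rewrite real_scalar_lt modulusM modulus_real_scalar (ger0_norm (ltW c0)) => h.
have -> : 2 / r * vnorm x = c^-1 by rewrite /c invf_div mulrAC.
by rewrite -[c^-1]mulr1 ler_pdivlMl // ltW.
Qed.

Lemma bounded_continuous_form (f : X -> K^o) C : linear f ->
  (forall x, modulus (f x) <= C * vnorm x) -> f \in @continuous_linear_form K X.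
Proof.
move=> lf bf; apply/asboolP; split=> // x.
apply/cvgrPdist_lt => e e0.
pose r := realpart e; have eE : e = real_scalar s r by rewrite ge0_realpartK ?ltW.
have r0 : 0 < r by rewrite -(real_scalar_lt s) real_scalar0 -eE.
have C0 : 0 < `|C| + 1 by rewrite ltr_pwDr.
have d0 : 0 < real_scalar s (r / (`|C| + 1)).
  by rewrite -(real_scalar0 R s) real_scalar_lt divr_gt0.
apply/nbhs_ballP; exists (real_scalar s (r / (`|C| + 1))) => //= y.
rewrite -ball_normE /= vnormE real_scalar_lt => xy.
have -> : f x - f y = f (x - y).
  have -> : x - y = -1 *: y + x by rewrite scaleN1r addrC.
  by rewrite (lf (-1) y x) scaleN1r addrC.
rewrite modulusE eE real_scalar_lt (le_lt_trans (bf _)) //.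
rewrite (@le_lt_trans _ _ ((`|C| + 1) * vnorm (x - y))) //; last by rewrite mulrC -ltr_pdivlMr.
by rewrite ler_wpM2r ?vnorm_ge0 // (le_trans (ler_norm _)) // lerDl.
Qed.

Lemma dual_norm_has_sup f :
  has_sup [set realpart `|f x| | x in [set x : X | vnorm x <= 1]].
Proof.
split; first by exists (realpart `|f 0|), 0 => //=; rewrite vnorm0.
have [C C0 fC] := dual_bounded f; exists C => _ [x /= x1 <-].
by rewrite (le_trans (fC x)) // ler_piMr // ltW.
Qed.

Lemma dual_norm_ge f x : vnorm x <= 1 -> modulus (f x) <= dual_norm f.
Proof.
by move=> x1; apply: sup_upper_bound; [exact: dual_norm_has_sup | exists x].
Qed.

Lemma dual_norm_ge0 f : 0 <= dual_norm f.
Proof.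
by apply: le_trans (modulus_ge0 (f 0)) _; rewrite dual_norm_ge // vnorm0.
Qed.

Lemma dual_norm_le f c : (forall x, vnorm x <= 1 -> modulus (f x) <= c) ->
  dual_norm f <= c.
Proof.
move=> h; apply: ge_sup; first by case: (dual_norm_has_sup f).
by move=> _ [x /= x1 <-]; apply: h.
Qed.

Lemma dual_normP f x : modulus (f x) <= dual_norm f * vnorm x.
Proof.
have [x0|xn0] := eqVneq (vnorm x) 0.
  by rewrite (vnorm0_eq0 x0) dual_at0 modulus0 vnorm0 mulr0.
have vx0 : 0 < vnorm x by rewrite lt0r xn0 vnorm_ge0.
have := @dual_norm_ge f (real_scalar s (vnorm x)^-1 *: x).
rewrite vnormZ dual_scale modulusM modulus_real_scalar ger0_norm ?invr_ge0 ?vnorm_ge0 //.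
by rewrite mulVf // lexx => /(_ isT); rewrite mulrC ler_pdivrMr.
Qed.

End NormAndDual.

Section Isometry.
Variables (R : realType) (s : scalar_kind).
Local Notation K := (scalar_field R s).
Variables (V : lmodType K) (N : V -> R) (J : V -> V).
Hypothesis hJ : is_isometry N J.

Lemma isometryD x y : J (x + y) = J x + J y.
Proof. by case: hJ => lin _ _; have := lin 1 x y; rewrite !scale1r. Qed.

Lemma isometry0 : J 0 = 0.
Proof. by apply: (addrI (J 0)); rewrite -isometryD !addr0. Qed.

Lemma isometryZ a x : J (a *: x) = a *: J x.
Proof. by case: hJ => lin _ _; have := lin a x 0; rewrite !addr0 isometry0 addr0. Qed.

Lemma isometryN x : J (- x) = - J x.
Proof. by rewrite -[- x]scaleN1r isometryZ scaleN1r. Qed.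

Lemma isometryB x y : J (x - y) = J x - J y.
Proof. by rewrite isometryD isometryN. Qed.

Lemma isometry_sum (I : Type) (A : seq I) (v : I -> V) :
  J (\sum_(i <- A) v i) = \sum_(i <- A) J (v i).
Proof. exact: (big_morph _ isometryD isometry0). Qed.

Lemma isometryE x : N (J x) = N x.
Proof. by case: hJ. Qed.

Lemma isometry_inverse : (forall x, N x = 0 -> x = 0) -> N 0 = 0 ->
  exists J', [/\ cancel J J', cancel J' J & is_isometry N J'].
Proof.
move=> N0 N00; have Jinj : injective J.
  move=> x y xy; apply/eqP; rewrite -subr_eq0; apply/eqP/N0.
  by rewrite -isometryE isometryB xy subrr.
have Jsurj : forall y, exists x, J x = y by case: hJ.
have [J' J'K] := choice Jsurj.
have JK x : J' (J x) = x by apply: Jinj.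
exists J'; split=> //; split.
- by move=> a x y; apply: Jinj; rewrite isometryD isometryZ !J'K.
- by move=> y; exists (J y).
- by move=> x; rewrite -{2}[x]J'K isometryE.
Qed.

End Isometry.

(** * Combinatorial bases *)

Section FsetSums.
Variables (V : nmodType) (I : choiceType).
Implicit Types (A B : {fset I}) (u v : I -> V).

Lemma eq_fsum A u v : (forall i, i \in A -> u i = v i) ->
  \sum_(i <- A) u i = \sum_(i <- A) v i.
Proof. by move=> uv; apply: eq_fbigr => i /uv. Qed.

Lemma fsumID A B u :
  \sum_(i <- A) u i = \sum_(i <- (A `&` B)%fset) u i + \sum_(i <- (A `\` B)%fset) u i.
Proof.
rewrite (big_fsetID _ (mem B)) /=; congr (_ + _); apply: eq_fbigl => i.
  by rewrite !inE.
by rewrite !inE andbC.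
Qed.

Lemma fsum_restrict A B u :
  \sum_(i <- (A `&` B)%fset) u i = \sum_(i <- B) (if i \in A then u i else 0).
Proof.
rewrite [RHS](fsumID _ A) [X in _ + X]big1_fset ?addr0; last first.
  by move=> i /fsetDP[_ /negPf ->].
rewrite fsetIC; apply: eq_fsum => i /fsetIP[_ ->] //.
Qed.

End FsetSums.

Section Basis.
Variables (R : realType) (s : scalar_kind).
Local Notation K := (scalar_field R s).
Local Notation modulus := (@modulus R s).
Implicit Types (A B : {fset nat}) (u v : nat -> K).

Definition lpsum (r : R) A u : R := \sum_(i <- A) modulus (u i) `^ r.

Lemma lpsum_ge0 r A u : 0 <= lpsum r A u.
Proof. by apply: sumr_ge0 => i _; apply: powR_ge0. Qed.

Lemma eq_lpsum r A u v : (forall i, i \in A -> u i = v i) -> lpsum r A u = lpsum r A v.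
Proof. by move=> uv; apply: eq_fsum => i /uv ->. Qed.

Lemma lpsumID r A B u : lpsum r A u = lpsum r (A `&` B)%fset u + lpsum r (A `\` B)%fset u.
Proof. exact: fsumID. Qed.

Lemma lpsum_sub r A B u : (A `<=` B)%fset -> lpsum r A u <= lpsum r B u.
Proof.
move=> AB; rewrite (lpsumID r B A) (fsetIidPr AB).
by rewrite lerDl lpsum_ge0.
Qed.

Lemma lpsum1 r i u : lpsum r [fset i]%fset u = modulus (u i) `^ r.
Proof. exact: big_seq_fset1. Qed.

Lemma modulus_le_lpsum r A u i : i \in A -> modulus (u i) `^ r <= lpsum r A u.
Proof. by move=> iA; rewrite -lpsum1 lpsum_sub // fsub1set. Qed.

Lemma lpsumZ r A u (c : K) : lpsum r A (fun i => c * u i) = modulus c `^ r * lpsum r A u.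
Proof.
rewrite /lpsum mulr_sumr; apply: eq_bigr => i _.
by rewrite modulusM powRM ?modulus_ge0.
Qed.

Variable X : normedModType K.
Variable e : nat -> X.

Definition lin_comb A u : X := \sum_(i <- A) u i *: e i.

(* What [is_completion] says about the vectors [e i] of X alone. *)
Definition combinatorial_basis (F : set {fset nat}) (p : R) : Prop :=
  [/\ forall A B u, F B -> (B `<=` A)%fset ->
        lpsum p B u <= vnorm (lin_comb A u) `^ p,
      forall A u c, 0 <= c ->
        (forall B, F B -> (B `<=` A)%fset -> lpsum p B u <= c `^ p) ->
        vnorm (lin_comb A u) <= c
    & forall x eps, 0 < eps -> exists A u, vnorm (x - lin_comb A u) < eps].

Lemma eq_lin_comb A u v : (forall i, i \in A -> u i = v i) ->
  lin_comb A u = lin_comb A v.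
Proof. by move=> uv; apply: eq_fsum => i /uv ->. Qed.

Lemma lin_combID A B u :
  lin_comb A u = lin_comb (A `&` B)%fset u + lin_comb (A `\` B)%fset u.
Proof. exact: fsumID. Qed.

Lemma lin_combD A u v : lin_comb A (fun i => u i + v i) = lin_comb A u + lin_comb A v.
Proof.
by rewrite /lin_comb -big_split; apply: eq_bigr => i _; rewrite scalerDl.
Qed.

Lemma lin_combZ A u (c : K) : lin_comb A (fun i => c * u i) = c *: lin_comb A u.
Proof.
by rewrite /lin_comb scaler_sumr; apply: eq_bigr => i _; rewrite scalerA.
Qed.

Lemma dual_lin_comb (f : dual_space X) A u :
  f (lin_comb A u) = \sum_(i <- A) u i * f (e i).
Proof. by rewrite dual_at_sum; apply: eq_bigr => i _; rewrite dual_scale. Qed.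

Section Theory.
Variables (F : set {fset nat}) (p : R).
Hypotheses (hF : combinatorial F) (he : combinatorial_basis F p) (p1 : 1 < p).
Local Notation q := (p / (p - 1)).

Let p0 : 0 < p. Proof. by apply: lt_trans p1. Qed.
Let pn0 : p != 0. Proof. by rewrite gt_eqF. Qed.
Let q0 : 0 < q. Proof. by rewrite divr_gt0 // subr_gt0. Qed.
Let qn0 : q != 0. Proof. by rewrite gt_eqF. Qed.
Let pq : p^-1 + q^-1 = 1.
Proof. by field; rewrite pn0 subr_eq0 gt_eqF. Qed.

Let pVE : p^-1 = 1 - q^-1.
Proof. by apply/eqP; rewrite eq_sym subr_eq pq. Qed.

Lemma vnorm_lin_comb_ge A B u : F B -> (B `<=` A)%fset ->
  lpsum p B u <= vnorm (lin_comb A u) `^ p.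
Proof. by case: he => h _ _; apply: h. Qed.

Lemma vnorm_lin_comb_le A u c : 0 <= c ->
  (forall B, F B -> (B `<=` A)%fset -> lpsum p B u <= c `^ p) ->
  vnorm (lin_comb A u) <= c.
Proof. by case: he => _ h _; apply: h. Qed.

Lemma vnorm_lin_comb_lp A u c : 0 <= c -> lpsum p A u <= c `^ p ->
  vnorm (lin_comb A u) <= c.
Proof.
by move=> c0 h; apply: vnorm_lin_comb_le => // B _ /(lpsum_sub p u)/le_trans; apply.
Qed.

Lemma vnorm_lin_comb_lt A u c : 0 <= c -> c < vnorm (lin_comb A u) ->
  exists B, [/\ F B, (B `<=` A)%fset & c `^ p < lpsum p B u].
Proof.
move=> c0 cv; apply: contrapT => nB; move: cv; rewrite ltNge; apply/negP.
rewrite negbK; apply: vnorm_lin_comb_le => // B FB BA; rewrite leNgt.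
by apply/negP => cB; apply: nB; exists B.
Qed.

Lemma vnorm_lin_comb_le1 A B u : F B -> (B `<=` A)%fset ->
  vnorm (lin_comb A u) <= 1 -> lpsum p B u <= 1.
Proof.
move=> FB BA u1; apply: le_trans (vnorm_lin_comb_ge u FB BA) _.
by rewrite -[X in _ <= X](one_powR p) powR_le ?vnorm_ge0 // ltW.
Qed.

Lemma vnorm_lin_comb_sub A B u : (A `<=` B)%fset ->
  vnorm (lin_comb A u) <= vnorm (lin_comb B u).
Proof.
move=> AB; apply: vnorm_lin_comb_le => [|C FC CA]; first exact: vnorm_ge0.
by apply: vnorm_lin_comb_ge => //; apply: fsubset_trans AB.
Qed.

Lemma vnorm_basis i : vnorm (e i) <= 1.
Proof.
have -> : e i = lin_comb [fset i]%fset (fun=> 1).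
  by rewrite /lin_comb big_seq_fset1 scale1r.
by apply: vnorm_lin_comb_lp => //; rewrite lpsum1 modulus1.
Qed.

Lemma modulus_le_vnorm A u i : i \in A -> modulus (u i) <= vnorm (lin_comb A u).
Proof.
move=> iA; apply: (@powR_le_inv _ p) => //; rewrite ?vnorm_ge0 ?modulus_ge0 //.
by rewrite -lpsum1 vnorm_lin_comb_ge //; [case: hF | rewrite fsub1set].
Qed.

Lemma dual_le_dense (f : dual_space X) c : 0 <= c ->
  (forall A u, vnorm (lin_comb A u) <= 1 -> modulus (f (lin_comb A u)) <= c) ->
  forall x, modulus (f x) <= c * vnorm x.
Proof.
move=> c0 h.
have h1 A u : modulus (f (lin_comb A u)) <= c * vnorm (lin_comb A u).
  have [v0|vn0] := eqVneq (vnorm (lin_comb A u)) 0.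
    by rewrite (vnorm0_eq0 v0) dual_at0 modulus0 vnorm0 mulr0.
  set r := vnorm _ in vn0 *; have r0 : 0 < r by rewrite lt0r vn0 vnorm_ge0.
  have := h A (fun i => real_scalar s r^-1 * u i).
  rewrite lin_combZ vnormZ dual_scale modulusM modulus_real_scalar.
  rewrite ger0_norm ?invr_ge0 ?vnorm_ge0 // mulVf // lexx => /(_ isT).
  by rewrite mulrC ler_pdivrMr.
move=> x; have [C C0 fC] := dual_bounded f.
apply/ler_addgt0Pr => eps eps0.
have Cc : 0 < C + c by apply: ltr_wpDr.
have [_ _ /(_ x (eps / (C + c)) (divr_gt0 eps0 Cc)) [A [u xu]]] := he.
have -> : f x = f (x - lin_comb A u) + f (lin_comb A u) by rewrite -dual_add subrK.
apply: le_trans (modulusD _ _) _.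
apply: le_trans (lerD (fC _) (h1 A u)) _.
have : vnorm (lin_comb A u) <= vnorm x + vnorm (x - lin_comb A u).
  have {1}-> : lin_comb A u = x + (lin_comb A u - x) by rewrite addrC subrK.
  by rewrite vnormBC vnormD.
move=> /(ler_wpM2l c0) h2.
apply: le_trans (lerD (lexx _) h2) _.
rewrite mulrDr addrCA lerD2l -mulrDl mulrC.
by rewrite -ler_pdivlMr // ltW.
Qed.

Lemma dual_norm_le_dense (f : dual_space X) c : 0 <= c ->
  (forall A u, vnorm (lin_comb A u) <= 1 -> modulus (f (lin_comb A u)) <= c) ->
  dual_norm f <= c.
Proof.
move=> c0 h; apply: dual_norm_le => x x1.
by apply: le_trans (dual_le_dense c0 h x) _; rewrite ler_piMr.
Qed.

Lemma dual_ext_basis (f g : dual_space X) : (forall i, f (e i) = g (e i)) -> f = g.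
Proof.
move=> fg; apply: dual_ext => x; apply/eqP; rewrite -subr_eq0 -modulus_eq0.
rewrite eq_le modulus_ge0 andbT -dualB -[X in _ <= X](mul0r (vnorm x)).
apply: dual_le_dense => // A u _; rewrite dualB !dual_lin_comb.
by under eq_bigr do rewrite fg; rewrite subrr modulus0.
Qed.

Lemma dual_norm_dense (f : dual_space X) c : 0 <= c -> c < dual_norm f ->
  exists A u, vnorm (lin_comb A u) <= 1 /\ c < realpart (f (lin_comb A u)).
Proof.
move=> c0 cf; apply: contrapT => nA; move: cf; rewrite ltNge; apply/negP.
rewrite negbK; apply: dual_norm_le_dense => // A u u1; rewrite leNgt.
apply/negP => cu; apply: nA; have [w w1 wE] := phase_exists (f (lin_comb A u)).
exists A, (fun i => w * u i); rewrite lin_combZ vnormZ w1 mul1r; split=> //.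
by rewrite dual_scale wE real_scalarK.
Qed.

(** On the vector with coefficients [dual_scalar q (f (e i))], f takes the value S while the norm is
    at most S^(1/p); then S <= S^(1/p), which fails for S > 1. *)
Lemma dual_norm1_lpsum (f : dual_space X) A : dual_norm f <= 1 -> F A ->
  lpsum q A (f \o e) <= 1.
Proof.
move=> f1 FA; set S := lpsum q A _.
have S0 : 0 <= S by apply: lpsum_ge0.
pose u i := dual_scalar q (f (e i)).
have fu : f (lin_comb A u) = real_scalar s S.
  rewrite dual_lin_comb /S /lpsum real_scalar_sum; apply: eq_bigr => i _.
  by rewrite mulrC mul_dual_scalar.
have uS : vnorm (lin_comb A u) <= S `^ p^-1.
  apply: vnorm_lin_comb_lp; first exact: powR_ge0.
  rewrite powRVK // /S /lpsum; apply: ler_sum => i _.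
  by rewrite (modulus_dual_scalar p0 q0 pq).
have := dual_normP f (lin_comb A u).
rewrite fu modulus_real_scalar ger0_norm // => /le_trans /(_ (ler_wpM2l (dual_norm_ge0 f) uS)).
move=> h; rewrite leNgt; apply/negP => S1.
have : S <= S `^ p^-1.
  by apply: le_trans h _; rewrite ler_piMl ?powR_ge0.
have -> : S `^ p^-1 = S * S `^ (- q^-1).
  rewrite {1}pVE.
  by rewrite powRD ?powRr1 // (gt_eqF (lt_trans ltr01 S1)) implybT.
rewrite -[X in X <= _]mulr1 ler_pM2l ?(lt_trans ltr01) // powRN.
rewrite leNgt invf_lt1 ?powR_gt0 ?(lt_trans ltr01) //.
by rewrite -[X in X < _](one_powR q^-1) powR_lt // invr_gt0.
Qed.

(* Shrinking: normalized blocks x_1 < ... < x_N with g(x_k) > eps would give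
   N eps <= |g| N^(1/p). *)
Lemma dual_tail (g : dual_space X) eps : 0 < eps -> exists n : nat, forall A u,
  (forall i, i \in A -> (n <= i)%N) -> vnorm (lin_comb A u) <= 1 ->
  modulus (g (lin_comb A u)) <= eps.
Proof.
move=> eps0; apply: contrapT => nn.
have blk (n : nat) : exists A u, [/\ forall i, i \in A -> (n <= i)%N,
    vnorm (lin_comb A u) <= 1 & eps < realpart (g (lin_comb A u))].
  apply: contrapT => nA; apply: nn; exists n => A u An u1; rewrite leNgt.
  apply/negP => cu; apply: nA; have [w w1 wE] := phase_exists (g (lin_comb A u)).
  exists A, (fun i => w * u i); rewrite lin_combZ vnormZ w1 mul1r; split=> //.
  by rewrite dual_scale wE real_scalarK.
have big (N : nat) : exists A u,
    (forall B, F B -> (B `<=` A)%fset -> lpsum p B u <= N%:R) /\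
    N%:R * eps <= realpart (g (lin_comb A u)).
  elim: N => [|N [A [u [Au gA]]]].
    exists fset0, (fun=> 0); split.
      by move=> B _; rewrite fsubset0 => /eqP ->; rewrite /lpsum big_seq_fset0.
    by rewrite mul0r /lin_comb big_seq_fset0 dual_at0 realpart0.
  have [A' [u' [A'n u'1 gA']]] := blk (\max_(k <- A) k).+1.
  have dAA' i : i \in A' -> i \in A = false.
    move=> /A'n iA'; apply/negP => iA; move: iA'; rewrite ltnNge.
    by rewrite leq_fset_max.
  pose v i := if i \in A then u i else u' i.
  have UA : ((A `|` A') `&` A = A)%fset by apply/fsetIidPr/fsubsetUl.
  have UA' : ((A `|` A') `\` A = A')%fset.
    apply/fsetP => i; rewrite !inE; case: (boolP (i \in A')) => [/dAA' ->//|_].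
    by rewrite orbF andNb.
  exists (A `|` A')%fset, v; split.
    move=> B FB BAA'; rewrite (lpsumID _ _ A) -natr1 lerD //.
      rewrite (@eq_lpsum _ _ _ u); last by move=> i /fsetIP[_ iA]; rewrite /v iA.
      by apply: Au; [apply: hF.2 FB _; apply: fsubsetIl | apply: fsubsetIr].
    rewrite (@eq_lpsum _ _ _ u'); last by move=> i /fsetDP[_ /negPf iA]; rewrite /v iA.
    apply: (vnorm_lin_comb_le1 (A := A')) => //.
      by apply: hF.2 FB _; apply: fsubsetDl.
    by rewrite -UA' fsetSD.
  rewrite (lin_combID _ A) UA UA' (@eq_lin_comb A v u); last by move=> i iA; rewrite /v iA.
  rewrite (@eq_lin_comb A' v u'); last by move=> i /dAA' iA; rewrite /v iA.
  by rewrite dual_add realpartD -natr1 mulrDl mul1r lerD // ltW.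
pose C := dual_norm g; have C0 : 0 <= C := dual_norm_ge0 g.
have bound (N : nat) : N%:R * eps <= C * N%:R `^ p^-1.
  have [A [u [Au gA]]] := big N; apply: le_trans gA _.
  apply: le_trans (realpart_le_modulus _) _; apply: le_trans (dual_normP _ _) _.
  rewrite ler_wpM2l // vnorm_lin_comb_le ?powR_ge0 // => B FB BA.
  by rewrite powRVK //; apply: Au.
(* Since 1 - 1/p = 1/q, any N > (C / eps)^q violates N eps <= C N^(1/p). *)
pose M := (C / eps) `^ q; have [N MN] : exists N : nat, M < N.+1%:R.
  by exists (Num.truncn M); apply: truncnS_gt.
have N0 : 0 < (N.+1%:R : R) by rewrite ltr0n.
have := bound N.+1; apply/negP; rewrite -ltNge.
have -> : N.+1%:R `^ p^-1 = N.+1%:R * N.+1%:R `^ (- q^-1) :> R.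
  rewrite {1}pVE.
  by rewrite powRD ?powRr1 // (gt_eqF N0) implybT.
rewrite mulrCA ltr_pM2l // powRN ltr_pdivrMr ?powR_gt0 // mulrC -ltr_pdivrMr //.
rewrite -[X in X < _](@powRK _ q) ?divr_ge0 // 1?ltW //.
by rewrite powR_lt ?powR_ge0 // invr_gt0.
Qed.

End Theory.
End Basis.

(** * Exposed functionals *)

Lemma seq_common_bound (R : realType) (A : seq nat) (P : nat -> R -> Prop) :
  (forall i r t, t <= r -> P i r -> P i t) ->
  (forall i, i \in A -> exists2 r, 0 < r & P i r) ->
  exists2 r, 0 < r & forall i, i \in A -> P i r.
Proof.
move=> mono; elim: A => [|i A IH] h; first by exists 1.
have [j jA|r r0 rP] := IH; first by apply: h; rewrite in_cons jA orbT.
have [t t0 tP] := h i (mem_head _ _).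
exists (Num.min r t); first by rewrite lt_min r0.
move=> j; rewrite in_cons => /predU1P[->|/rP].
  by apply: mono tP; rewrite ge_min lexx orbT.
by apply: mono; rewrite ge_min lexx.
Qed.

Section Coordinates.
Variables (R : realType) (s : scalar_kind).
Local Notation K := (scalar_field R s).
Local Notation modulus := (@modulus R s).
Implicit Types (A B : {fset nat}) (u v : nat -> K).
Variable X : normedModType K.
Variable e : nat -> X.
Variables (F : set {fset nat}) (p : R).
Hypotheses (hF : combinatorial F) (he : combinatorial_basis e F p) (p1 : 1 < p).
Local Notation q := (p / (p - 1)).

Let p0 : 0 < p. Proof. by apply: lt_trans p1. Qed.
Let pn0 : p != 0. Proof. by rewrite gt_eqF. Qed.
Let q0 : 0 < q. Proof. by rewrite divr_gt0 // subr_gt0. Qed.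
Let qn0 : q != 0. Proof. by rewrite gt_eqF. Qed.
Let pq : p^-1 + q^-1 = 1.
Proof. by field; rewrite pn0 subr_eq0 gt_eqF. Qed.
Let qp : q^-1 + p^-1 = 1. Proof. by rewrite addrC. Qed.

Variable es : nat -> dual_space X.
Hypothesis hes : forall i j, es i (e j) = (i == j)%:R.

Definition dual_comb A (a : nat -> K) : dual_space X := \sum_(i <- A) a i *: es i.

Lemma dual_combE A a j : dual_comb A a (e j) = if j \in A then a j else 0.
Proof.
rewrite dual_sum; case: ifP => [jA|jA].
  rewrite (big_fsetD1 j) // dualZ hes eqxx mulr1 big1_fset; first exact: addr0.
  by move=> i /fsetD1P[/negPf ij _] _; rewrite dualZ hes ij mulr0.
rewrite big1_fset // => i iA _; rewrite dualZ hes.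
by case: eqP => [ij|]; rewrite ?mulr0 //; rewrite ij jA in iA.
Qed.

Lemma dual_comb_lin_comb A a B u :
  dual_comb A a (lin_comb e B u) = \sum_(i <- (A `&` B)%fset) u i * a i.
Proof.
rewrite dual_lin_comb fsum_restrict; apply: eq_bigr => i _.
by rewrite dual_combE; case: ifP; rewrite ?mulr0.
Qed.

(** Young's inequality summed over the common indices; the l_p sum of u there is at most 1 because
    [A] is in [F]. *)
Lemma dual_norm_comb A a : F A -> lpsum q A a <= 1 -> dual_norm (dual_comb A a) <= 1.
Proof.
move=> FA a1; apply: (dual_norm_le_dense he) => // B u u1.
rewrite dual_comb_lin_comb; apply: le_trans (modulus_sum _ _) _.
have u1' : lpsum p (A `&` B)%fset u <= 1.
  apply: (vnorm_lin_comb_le1 he p1 _ _ u1); last exact: fsubsetIr.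
  by apply: hF.2 FA _; apply: fsubsetIl.
have a1' : lpsum q (A `&` B)%fset a <= 1.
  by apply: le_trans a1; apply: lpsum_sub; apply: fsubsetIl.
apply: (@le_trans _ _ (lpsum p (A `&` B)%fset u / p + lpsum q (A `&` B)%fset a / q)).
  rewrite /lpsum !mulr_suml -big_split; apply: ler_sum => i _ /=.
  by rewrite modulusM; apply: conjugate_powR; rewrite ?modulus_ge0.
have pV : 0 < p^-1 by rewrite invr_gt0.
have qV : 0 < q^-1 by rewrite invr_gt0.
rewrite -[X in _ <= X]pq lerD //.
  by rewrite -[X in _ <= X]mul1r ler_pM2r.
by rewrite -[X in _ <= X]mul1r ler_pM2r.
Qed.

Lemma dual_norm_coord (f : dual_space X) i : modulus (f (e i)) <= dual_norm f.
Proof. by rewrite dual_norm_ge // (vnorm_basis he). Qed.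

Lemma dual_norm_eq0 (f : dual_space X) : dual_norm f = 0 -> f = 0.
Proof.
move=> f0; apply: (dual_ext_basis he) => i; apply/eqP.
rewrite dual0 -modulus_eq0 eq_le modulus_ge0 andbT.
by rewrite -f0 dual_norm_coord.
Qed.

Lemma dual_norm0 : dual_norm (0 : dual_space X) = 0.
Proof.
apply/le_anti; rewrite dual_norm_ge0 andbT; apply: dual_norm_le => x _.
by rewrite dual0 modulus0.
Qed.

Lemma dual_isometry_inverse J : is_isometry (@dual_norm R s X) J ->
  exists J', [/\ cancel J J', cancel J' J & is_isometry (@dual_norm R s X) J'].
Proof. move=> hJ; apply: isometry_inverse hJ dual_norm_eq0 dual_norm0. Qed.

Lemma dual_norm_es i : dual_norm (es i) = 1.
Proof.
apply/le_anti/andP; split; last first.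
  by apply: le_trans (dual_norm_coord _ i); rewrite hes eqxx modulus1.
have -> : es i = dual_comb [fset i]%fset (fun=> 1).
  by rewrite /dual_comb big_seq_fset1 scale1r.
apply: dual_norm_comb; first by case: hF.
by rewrite lpsum1 modulus1 one_powR.
Qed.

Definition below (n : nat) : {fset nat} := [fset i in iota 0 n]%fset.

Lemma in_below n i : (i \in below n) = (i < n)%N.
Proof. by rewrite !inE mem_iota. Qed.

Definition partial_dual (n : nat) (g : dual_space X) : dual_space X :=
  dual_comb (below n) (g \o e).

Lemma partial_dual_cvg g eps : 0 < eps ->
  exists n0, forall n, (n0 <= n)%N -> dual_norm (g - partial_dual n g) <= eps.
Proof.
move=> eps0; have [n0 nP] := dual_tail hF he p1 g eps0.
exists n0 => n n0n; apply: (dual_norm_le_dense he); first exact: ltW.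
move=> A u u1; pose T := [fset i in A | (n <= i)%N]%fset.
have -> : (g - partial_dual n g) (lin_comb e A u) = g (lin_comb e T u).
  rewrite !dual_lin_comb; have TE : T = (T `&` A)%fset.
    by apply/esym/fsetIidPl/fsubsetP => i; rewrite !inE => /andP[].
  rewrite [in RHS]TE fsum_restrict; apply: eq_fsum => i iA.
  rewrite dualB dual_combE in_below !inE iA /= ltnNge.
  by case: leqP => _; rewrite ?subr0 // subrr mulr0.
apply: nP.
  by move=> i; rewrite !inE => /andP[_]; apply: leq_trans.
apply: le_trans u1; apply: (vnorm_lin_comb_sub he).
by apply/fsubsetP => i; rewrite !inE => /andP[].
Qed.

(** Equality in Young's inequality against a, coordinate by coordinate; this is the vector exposing
    [dual_comb A a]. *)
Definition norming A (a : nat -> K) : X := lin_comb e A (fun i => dual_scalar q (a i)).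

Lemma lpsum_norming A (a : nat -> K) :
  lpsum p A (fun i => dual_scalar q (a i)) = lpsum q A a.
Proof.
by apply: eq_bigr => i _; rewrite (modulus_dual_scalar p0 q0 pq).
Qed.

Lemma vnorm_norming A a : lpsum q A a <= 1 -> vnorm (norming A a) <= 1.
Proof.
move=> a1; rewrite /norming; apply: (vnorm_lin_comb_lp he) => //.
by rewrite lpsum_norming one_powR.
Qed.

Lemma dual_comb_norming A a : dual_comb A a (norming A a) = real_scalar s (lpsum q A a).
Proof.
rewrite dual_comb_lin_comb fsetIid /lpsum real_scalar_sum.
by apply: eq_bigr => i _; rewrite mulrC mul_dual_scalar.
Qed.

(* On the support of [a], a functional almost normed by [norming A a] is close
   to [a] by Young's inequality; off the support it is small because the norm of
   [norming A a + t y] is at most [1 + t^p] there, with p > 1. *)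
Lemma strongly_exposed A a eps : F A -> lpsum q A a = 1 -> 0 < eps ->
  exists2 dl, 0 < dl & forall h : dual_space X, dual_norm h <= 1 ->
    1 - dl <= realpart (h (norming A a)) -> dual_norm (h - dual_comb A a) <= eps.
Proof.
move=> FA a1 eps0; pose x := norming A a.
(* The indices of [A] share eps / 2, at most eps / (2 m) each; the summand 1 keeps m positive when
   [A] is empty. *)
pose m : R := #|` A|%:R + 1.
have m0 : 0 < m by rewrite ltr_wpDl.
pose e1 := eps / (2 * m); have e10 : 0 < e1 by rewrite divr_gt0 // mulr_gt0.
pose P i r := forall z : K,
  modulus (dual_scalar q (a i)) `^ p / p + modulus z `^ q / q
    - realpart (dual_scalar q (a i) * z) <= r -> modulus (z - a i) <= e1.
have [i r t tr Pr z zt|i iA|r r0 rP] := @seq_common_bound R (enum_fset A) P.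
- by apply: Pr; apply: le_trans tr.
- have [dl dl0 dlP] := young_modulus q0 p0 qp (dual_scalar q (a i)) e10.
  by exists dl => // z /dlP; rewrite (dual_scalarK p0 q0 pq).
(* Solves t^p = t (eps / 4). Dividing 1 - dl + t |h y| <= 1 + t^p by t then gives |h y| <= eps / 4 +
   eps / 4. *)
pose t := (eps / 4) `^ (p - 1)^-1.
have t0 : 0 < t by rewrite powR_gt0 // divr_gt0.
have p10 : p - 1 != 0 by rewrite subr_eq0 gt_eqF.
have tp : t `^ p = t * (eps / 4).
  rewrite -[X in _ * X](@powRVK _ (p - 1)) ?divr_ge0 ?(ltW eps0) // -/t.
  by rewrite mulr_powRB1 // ltW.
pose dl := Num.min r (t * (eps / 4)).
have [dlr dlt] : dl <= r /\ dl <= t * (eps / 4) by rewrite /dl !ge_min !lexx orbT.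
exists dl; first by rewrite lt_min r0 mulr_gt0 // divr_gt0.
move=> h h1 hx.
have near i : i \in A -> modulus (h (e i) - a i) <= e1.
  move=> iA; apply: (rP i iA); apply: le_trans dlr.
  (* Young's defects are nonnegative and sum up to at most 1/p + 1/q - Re h(x) <= dl, so each one is
     at most dl. *)
  pose phi j := modulus (dual_scalar q (a j)) `^ p / p + modulus (h (e j)) `^ q / q
    - realpart (dual_scalar q (a j) * h (e j)).
  have phi0 j : 0 <= phi j by rewrite subr_ge0; apply: (young q0 p0 qp).
  apply: (@le_trans _ _ (\sum_(j <- A) phi j)).
    by rewrite (big_fsetD1 i) //= lerDl sumr_ge0.
  rewrite /phi sumrB big_split /= -!mulr_suml -realpart_sum.
  have -> : \sum_(j <- A) dual_scalar q (a j) * h (e j) = h x by rewrite dual_lin_comb.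
  have hA := dual_norm1_lpsum he p1 h1 FA.
  have pV : 0 < p^-1 by rewrite invr_gt0.
  have qV : 0 < q^-1 by rewrite invr_gt0.
  have -> : \sum_(j <- A) modulus (dual_scalar q (a j)) `^ p = 1.
    exact: etrans (lpsum_norming A a) a1.
  have hq : (\sum_(j <- A) modulus (h (e j)) `^ q) / q <= q^-1.
    by rewrite -[X in _ <= X]mul1r ler_pM2r.
  rewrite -/x in hx; rewrite mul1r; apply: le_trans (lerB (lerD (lexx _) hq) hx) _.
  by rewrite pq opprB addrC subrK.
apply: (dual_norm_le_dense he); first exact: ltW.
move=> B u u1.
have eps_half : eps / 2 + eps / 2 = eps by field.
rewrite dual_lin_comb (fsumID _ A) -[eps in _ <= eps]eps_half.
apply: le_trans (modulusD _ _) _; apply: lerD.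
  apply: le_trans (modulus_sum _ _) _.
  apply: (@le_trans _ _ (\sum_(i <- (B `&` A)%fset) e1)).
    rewrite [X in X <= _]big_seq [X in _ <= X]big_seq; apply: ler_sum => i /fsetIP[iB iA].
    rewrite modulusM dualB dual_combE iA -[e1]mul1r ler_pM ?modulus_ge0 ?near //.
    by apply: le_trans u1; apply: (modulus_le_vnorm hF he p1).
  rewrite big_const_seq count_predT iter_addr_0 -[X in X <= _]mulr_natr.
  have : (size (B `&` A)%fset)%:R <= m.
    apply: (@le_trans _ _ (#|` A|%:R)); last by rewrite lerDl.
    by rewrite ler_nat fsubset_leq_card // fsubsetIr.
  move=> /(ler_wpM2l (ltW e10)) /le_trans; apply.
  by rewrite /e1; have -> : eps / (2 * m) * m = eps / 2 by field; rewrite gt_eqF.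
have -> : \sum_(i <- (B `\` A)%fset) u i * (h - dual_comb A a) (e i) =
    h (lin_comb e (B `\` A)%fset u).
  rewrite dual_lin_comb; apply: eq_fsum => i /fsetDP[_ /negPf iA].
  by rewrite dualB dual_combE iA subr0.
set y := lin_comb e _ u.
have [w w1 wE] := phase_exists (h y).
pose c : K := real_scalar s t * w.
have mc : modulus c = t by rewrite modulusM w1 mulr1 modulus_real_scalar ger0_norm // ltW.
pose v i := if i \in A then dual_scalar q (a i) else c * u i.
have UA : ((A `|` B) `&` A = A)%fset by apply/fsetIidPr/fsubsetUl.
have UB : ((A `|` B) `\` A = B `\` A)%fset.
  by apply/fsetP => i; rewrite !inE; case: (i \in A).
have xy : x + c *: y = lin_comb e (A `|` B)%fset v.
  rewrite (lin_combID _ _ A) UA UB -lin_combZ; congr (_ + _); apply: eq_lin_comb => i.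
    by rewrite /v => ->.
  by rewrite /v => /fsetDP[_ /negPf ->].
have vx : vnorm (x + c *: y) <= 1 + t `^ p.
  have tp0 : 0 <= t `^ p by apply: powR_ge0.
  rewrite xy; apply: (vnorm_lin_comb_le he); first by rewrite addr_ge0.
  move=> G FG GAB; rewrite (lpsumID _ _ A).
  apply: (@le_trans _ _ (1 + t `^ p)); last first.
    rewrite -[X in X <= _]powRr1 ?addr_ge0 // ler_powR //; last exact: ltW.
    by rewrite lerDl.
  apply: lerD.
    rewrite (@eq_lpsum _ _ _ _ _ (fun i => dual_scalar q (a i))); last first.
      by move=> i /fsetIP[_ iA]; rewrite /v iA.
    by rewrite -[X in _ <= X]a1 -lpsum_norming lpsum_sub // fsubsetIr.
  rewrite (@eq_lpsum _ _ _ _ _ (fun i => c * u i)); last first.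
    by move=> i /fsetDP[_ /negPf iA]; rewrite /v iA.
  rewrite lpsumZ mc ler_piMr //.
  apply: (vnorm_lin_comb_le1 he p1 _ _ u1); first by apply: hF.2 FG _; apply: fsubsetDl.
  apply/fsubsetP => i /fsetDP[/(fsubsetP GAB)]; rewrite in_fsetU.
  by case: (i \in A).
have : realpart (h (x + c *: y)) <= 1 + t `^ p.
  apply: le_trans (realpart_le_modulus _) _; apply: le_trans (dual_normP _ _) _.
  by apply: le_trans vx; rewrite ler_piMl ?vnorm_ge0.
rewrite dual_add dual_scale realpartD -mulrA wE realpartZ real_scalarK tp => hxy.
rewrite -(ler_pM2l t0); rewrite -/x in hx.
have -> : t * (eps / 2) = t * (eps / 4) + t * (eps / 4) by field.
lra.
Qed.

(** The coefficients [dual_scalar p (u i)] have l_q sum S and pairing S with u; the factor S^(-1/q)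
    turns these into 1 and S^(1/p). *)
Lemma norming_coefficients B u : 0 < lpsum p B u -> exists2 b : nat -> K,
  lpsum q B b = 1 & \sum_(i <- B) b i * u i = real_scalar s (lpsum p B u `^ p^-1).
Proof.
set S := lpsum p B u => S0.
exists (fun i => real_scalar s (S `^ (- q^-1)) * dual_scalar p (u i)).
  rewrite lpsumZ modulus_real_scalar ger0_norm ?powR_ge0 // -powRrM mulNr mulVf //.
  rewrite powR_inv1 ?(ltW S0) //.
  rewrite (_ : lpsum q B _ = S) ?mulVf ?gt_eqF //.
  by apply: eq_bigr => i _; rewrite (modulus_dual_scalar q0 p0 qp).
rewrite (eq_bigr (fun i => real_scalar s (S `^ (- q^-1)) *
    real_scalar s (modulus (u i) `^ p))); last first.
  by move=> i _; rewrite -mulrA [X in _ * X]mulrC (mul_dual_scalar p0).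
rewrite -mulr_sumr -real_scalar_sum -real_scalarM mulrC; congr real_scalar.
have -> : p^-1 = 1 - q^-1 by apply/eqP; rewrite eq_sym subr_eq pq.
by rewrite powRD ?powRr1 ?(ltW S0) // (gt_eqF S0) implybT.
Qed.

(* [g = J f] is norming for the functional [f' |->
   (J^-1 f') x] that exposes [f]; since finitely supported elements of the
   l_q-spheres over F are norming for it too, [g] is a norm limit of them. *)
Lemma isometry_support (J : dual_space X -> dual_space X) H a A :
  is_isometry (@dual_norm R s X) J -> F H -> lpsum q H a = 1 ->
  (forall i, i \in A -> J (dual_comb H a) (e i) != 0) -> F A.
Proof.
move=> hJ FH a1 supp; set f0 := dual_comb H a in supp; pose g := J f0.
have [J' [JK J'K hJ']] := dual_isometry_inverse hJ.
pose x := norming H a.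
have x1 : vnorm x <= 1 by apply: vnorm_norming; rewrite a1.
have f01 : dual_norm f0 <= 1 by apply: dual_norm_comb; rewrite // a1.
pose P i r := r < modulus (g (e i)).
have [i r t tr|i iA|eps eps0 epsP] := @seq_common_bound R (enum_fset A) P.
- exact: le_lt_trans.
- exists (modulus (g (e i)) / 2); rewrite /P.
    by rewrite divr_gt0 // modulus_gt0 supp.
  have : 0 < modulus (g (e i)) by rewrite modulus_gt0 supp.
  lra.
have [dl' dl'0 dl'P] := strongly_exposed FH a1 eps0.
pose dl := Num.min dl' 1.
have [dl1 dl2] : dl <= dl' /\ dl <= 1 by rewrite /dl !ge_min !lexx orbT.
have dl0 : 0 < dl by rewrite lt_min dl'0 ltr01.
have dl20 : 0 < dl / 2 by rewrite divr_gt0.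
have [n /(_ n (leqnn n)) nP] := partial_dual_cvg g dl20.
(* An element of the unit ball of the bidual that takes the value 1 at g. *)
pose psi (f : dual_space X) : K := J' f x.
have psi_le f : modulus (psi f) <= dual_norm f.
  rewrite -(isometryE hJ'); apply: le_trans (dual_normP _ _) _.
  by rewrite ler_piMr // dual_norm_ge0.
pose u k := psi (es k).
have psi_comb B b : psi (dual_comb B b) = \sum_(i <- B) b i * u i.
  rewrite /psi /dual_comb (isometry_sum hJ') dual_sum; apply: eq_bigr => i _.
  by rewrite (isometryZ hJ').
(* The coordinates of psi below n, made into a vector of [X]: its pairing with g is the same finite
   sum as psi at the truncation of g, which is close to psi g = 1. *)
pose y := lin_comb e (below n) u.
have gy : g y = psi (partial_dual n g).
  by rewrite dual_lin_comb psi_comb; apply: eq_bigr => i _; rewrite mulrC.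
have psig : psi g = 1.
  by rewrite /psi JK dual_comb_norming a1 real_scalar1.
have gy_near : modulus (1 - g y) <= dl / 2.
  have -> : 1 - g y = psi (g - partial_dual n g).
    by rewrite gy -psig /psi (isometryB hJ') dualB.
  exact: le_trans (psi_le _) nP.
have g1 : dual_norm g <= 1 by rewrite (isometryE hJ).
have y_large : 1 - dl < vnorm y.
  apply: (@lt_le_trans _ _ (realpart (g y))).
    have := le_trans (realpart_le_modulus _) gy_near.
    rewrite realpartB realpart1; lra.
  apply: le_trans (realpart_le_modulus _) _; apply: le_trans (dual_normP _ _) _.
  by rewrite ler_piMl ?vnorm_ge0.
have dl1' : 0 <= 1 - dl by rewrite subr_ge0.
have [B [FB Bn BS]] := vnorm_lin_comb_lt he dl1' y_large.
have [b b1 bu] := norming_coefficients (le_lt_trans (powR_ge0 _ _) BS).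
have psib : psi (dual_comb B b) = real_scalar s (lpsum p B u `^ p^-1).
  by rewrite psi_comb.
have hn1 : dual_norm (J' (dual_comb B b)) <= 1.
  by rewrite (isometryE hJ') dual_norm_comb // b1.
have close : dual_norm (dual_comb B b - g) <= eps.
  rewrite -(isometryE hJ') (isometryB hJ') JK; apply: dl'P => //.
  rewrite -/(psi _) psib real_scalarK; apply: (@le_trans _ _ (1 - dl)); first by lra.
  rewrite -[X in X <= _](@powRK _ p) // powR_le ?powR_ge0 ?invr_ge0 ?(ltW p0) //.
  exact: ltW.
(* At an index of [A] outside [B] the difference [dual_comb B b - g] would have a coordinate of
   modulus above eps. *)
apply: hF.2 FB _; apply/fsubsetP => i iA; apply: contrapT => /negP /negPf iB.
have := epsP i iA; rewrite /P ltNge => /negP; apply.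
apply: le_trans close; apply: le_trans (dual_norm_coord _ i).
by rewrite dualB dual_combE iB sub0r modulusN.
Qed.

End Coordinates.

(** * Extremal functionals and isometries of the dual *)

(** Finitely many proper hyperplanes do not exhaust the coefficients: the coefficient of a k that
    sees the new g is raised by some t exceeding every ratio |L g' / M k g'|, so no sum can
    cancel. *)
Lemma generic_combination (K : numFieldType) (H : {fset nat}) (G : seq nat)
    (M : nat -> nat -> K) :
  (forall g, g \in G -> exists2 k, k \in H & M k g != 0) ->
  exists a : nat -> K, forall g, g \in G -> \sum_(k <- H) a k * M k g != 0.
Proof.
elim: G => [|g G IH] h; first by exists (fun=> 0).
have [g' g'G|a aP] := IH; first by apply: h; rewrite in_cons g'G orbT.
have [k kH Mkg] := h g (mem_head _ _).
pose L g' := \sum_(k <- H) a k * M k g'.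
pose t : K := 1 + \sum_(g' <- g :: G) `|L g' / M k g'|.
have t0 : 0 < t by rewrite ltr_wpDr // sumr_ge0.
have tP g' : g' \in g :: G -> `|L g' / M k g'| < t.
  move=> g'G; rewrite /t (big_rem g') //= addrCA ltr_pwDr //.
  by rewrite ltr_wpDr // sumr_ge0.
exists (fun k' => a k' + (if k' == k then t else 0)) => g' g'G.
have -> : \sum_(k' <- H) (a k' + (if k' == k then t else 0)) * M k' g' = L g' + t * M k g'.
  under eq_bigr do rewrite mulrDl.
  rewrite big_split /=; congr (_ + _); rewrite (big_fsetD1 k) //= eqxx big1_fset ?addr0 //.
  by move=> k' /fsetD1P[/negPf -> _] _; rewrite mul0r.
have [M0|M0] := eqVneq (M k g') 0.
  rewrite M0 mulr0 addr0; apply: aP; move: g'G; rewrite in_cons => /predU1P[g'g|//].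
  by move: Mkg; rewrite -g'g M0 eqxx.
apply/negP => /eqP/(canRL (addrK _)); rewrite sub0r => LE.
by have := tP _ g'G; rewrite LE -mulNr mulfK // normrN gtr0_norm // ltxx.
Qed.

Section Isometries.
Variables (R : realType) (s : scalar_kind).
Local Notation K := (scalar_field R s).
Local Notation modulus := (@modulus R s).
Implicit Types (A B : {fset nat}) (u v : nat -> K).
Variable X : normedModType K.
Variable e : nat -> X.
Variables (F : set {fset nat}) (p : R).
Hypotheses (hF : combinatorial F) (he : combinatorial_basis e F p) (p1 : 1 < p).
Local Notation q := (p / (p - 1)).

Let p0 : 0 < p. Proof. by apply: lt_trans p1. Qed.
Let pn0 : p != 0. Proof. by rewrite gt_eqF. Qed.
Let q0 : 0 < q. Proof. by rewrite divr_gt0 // subr_gt0. Qed.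
Let qn0 : q != 0. Proof. by rewrite gt_eqF. Qed.
Let pq : p^-1 + q^-1 = 1.
Proof. by field; rewrite pn0 subr_eq0 gt_eqF. Qed.
Let pV0 : 0 < p^-1. Proof. by rewrite invr_gt0. Qed.
Let qV0 : 0 < q^-1. Proof. by rewrite invr_gt0. Qed.

Variable es : nat -> dual_space X.
Hypothesis hes : forall i j, es i (e j) = (i == j)%:R.

Let F0 : F fset0.
Proof. by case: hF => F1 her; apply: her (F1 0%N) _; apply: fsub0set. Qed.

Lemma dual_normZ (c : K) (f : dual_space X) : dual_norm (c *: f) = modulus c * dual_norm f.
Proof.
have le d (h : dual_space X) : dual_norm (d *: h) <= modulus d * dual_norm h.
  apply: dual_norm_le => x x1; rewrite dualZ modulusM ler_wpM2l ?modulus_ge0 //.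
  exact: dual_norm_ge.
apply/le_anti; rewrite le /=; have [->|c0] := eqVneq c 0.
  by rewrite modulus0 mul0r dual_norm_ge0.
have := le c^-1 (c *: f); rewrite scalerA mulVf // scale1r modulusV.
by rewrite -ler_pdivrMl ?invr_gt0 ?modulus_gt0 // invrK.
Qed.

(* The extreme points of the dual ball: the unit sphere of l_q(A), where all
   finite subsets of A are in F. *)
Definition extremal (g : dual_space X) : Prop :=
  dual_norm g = 1 /\ forall A, (forall i, i \in A -> g (e i) != 0) -> F A.

Lemma dual_norm_comb1 A a : F A -> lpsum q A a = 1 -> dual_norm (dual_comb es A a) = 1.
Proof.
move=> FA a1; apply/le_anti; rewrite (dual_norm_comb hF he) ?a1 //=.
have x1 : vnorm (norming e p A a) <= 1 by apply: (vnorm_norming he); rewrite ?a1.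
have := dual_norm_ge (dual_comb es A a) x1.
by rewrite (dual_comb_norming p1 hes) a1 real_scalar1 modulus1.
Qed.

Lemma isometry_extremal J A a : is_isometry (@dual_norm R s X) J -> F A ->
  lpsum q A a = 1 -> extremal (J (dual_comb es A a)).
Proof.
move=> hJ FA a1; split; first by rewrite (isometryE hJ) dual_norm_comb1.
by move=> B; apply: (isometry_support hF he p1 hes hJ FA a1).
Qed.

Lemma dual_comb1 i : dual_comb es [fset i]%fset (fun=> 1) = es i.
Proof. by rewrite /dual_comb big_seq_fset1 scale1r. Qed.

Lemma isometry_extremal_es J i : is_isometry (@dual_norm R s X) J -> extremal (J (es i)).
Proof.
move=> hJ; rewrite -dual_comb1; apply: isometry_extremal => //.
  by case: hF.
by rewrite lpsum1 modulus1 one_powR.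
Qed.

Section Support.
Variable J : dual_space X -> dual_space X.
Hypothesis hJ : is_isometry (@dual_norm R s X) J.

Definition supports (k m : nat) : Prop := J (es k) (e m) != 0.

(** One generic combination over [A], scaled to the l_q sphere, has an image that is nonzero on all
    of [B], so [isometry_support] covers [B] at once. *)
Lemma supports_transport A B : F A -> linked supports A B -> F B.
Proof.
move=> FA /generic_combination [a aP].
have [->|/fset0Pn [b bB]] := eqVneq B fset0; first exact: F0.
set S := lpsum q A a.
have S0 : 0 < S.
  rewrite lt0r lpsum_ge0 andbT; apply/negP => /eqP S00.
  have := aP b bB; rewrite big1_fset ?eqxx // => k kA _.
  have : modulus (a k) `^ q <= 0 by rewrite -S00; apply: modulus_le_lpsum.
  rewrite le_eqVlt ltNge powR_ge0 orbF => /eqP/powR_eq0_eq0/eqP.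
  by rewrite modulus_eq0 => /eqP ->; rewrite mul0r.
pose c := real_scalar s (S `^ (- q^-1)).
have c0 : c != 0 by rewrite -modulus_eq0 modulus_real_scalar normr_eq0 gt_eqF // powR_gt0.
apply: (isometry_support hF he p1 hes hJ FA (a := fun k => c * a k)) => [|m mB].
  rewrite lpsumZ modulus_real_scalar ger0_norm ?powR_ge0 // -powRrM mulNr mulVf //.
  by rewrite powR_inv1 ?(ltW S0) // mulVf ?gt_eqF.
have -> : dual_comb es A (fun k => c * a k) = c *: dual_comb es A a.
  by rewrite /dual_comb scaler_sumr; apply: eq_bigr => k _; rewrite scalerA.
rewrite (isometryZ hJ) dualZ mulf_neq0 // (isometry_sum hJ) dual_sum.
under eq_bigr do rewrite (isometryZ hJ) dualZ.
exact: aP.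
Qed.

(** Otherwise the images of N.+2 independent functionals would be determined by their first N.+1
    coordinates, and a kernel vector would contradict the injectivity of [J]. *)
Lemma supports_wide : wide supports.
Proof.
move=> N; apply: contrapT => nex.
have z k m : (N < k)%N -> (N < m)%N -> J (es k) (e m) = 0.
  by move=> Nk Nm; apply/eqP/negPn/negP => h; apply: nex; exists k, m.
pose M : 'M[K]_(N.+2, N.+1) := \matrix_(i, j) J (es (N.+1 + i)%N) (e j).
have : kermx M != 0.
  rewrite kermx_eq0 /row_free; apply/negP => /eqP rkM.
  by have := rank_leq_col M; rewrite rkM ltnn.
move=> /rowV0Pn[v /sub_kermxP vM v0].
have Jv : J (\sum_(i < N.+2) v ord0 i *: es (N.+1 + i)%N) = 0.
  apply: (dual_ext_basis he) => m; rewrite (isometry_sum hJ) dual_sum dual0.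
  under eq_bigr do rewrite (isometryZ hJ) dualZ.
  have [mN|Nm] := ltnP m N.+1.
    have := congr1 (fun w : 'rV[K]_N.+1 => w ord0 (Ordinal mN)) vM.
    by rewrite !mxE; apply: etrans; apply: eq_bigr => i _; rewrite mxE.
  by rewrite big1 // => i _; rewrite z ?mulr0 // ltn_addr.
have v00 : \sum_(i < N.+2) v ord0 i *: es (N.+1 + i)%N = 0.
  by apply: (dual_norm_eq0 he); rewrite -(isometryE hJ) Jv dual_norm0.
move/negP: v0; apply; apply/eqP/rowP => j; rewrite mxE.
have := congr1 (fun f : dual_space X => f (e (N.+1 + j)%N)) v00.
rewrite dual_sum dual0 (bigD1 j) // big1 => [|i ij].
  by rewrite dualZ hes eqxx mulr1 => h; rewrite -[RHS]h; apply/esym/addr0.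
rewrite dualZ hes eqn_add2l; case: eqP => [ij'|_]; last by rewrite mulr0.
by move/eqP: ij; case; apply: val_inj.
Qed.

End Support.

Lemma finite_expansion (f : dual_space X) n :
  (forall m, (n <= m)%N -> f (e m) = 0) -> f = dual_comb es (below n) (f \o e).
Proof.
move=> fn; apply: (dual_ext_basis he) => m; rewrite (dual_combE hes) in_below.
by case: ltnP => // /fn.
Qed.

Lemma eigen_unimodular J i k (c : K) : is_isometry (@dual_norm R s X) J ->
  J (es i) = c *: es k -> modulus c = 1.
Proof.
move=> hJ Jc; have := isometryE hJ (es i).
by rewrite Jc dual_normZ !(dual_norm_es hF he p1 hes) mulr1.
Qed.

(** * Isometries of the duals of Schreier spaces *)

Section Schreier.
Variables (d : Order.disp_t) (W : orderType d).
Variables (S : W -> set {fset nat}) (approx : W -> nat -> W) (b : W).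
Hypotheses (hW : is_omega1 W) (hS : transfinite_schreier S approx).
Hypotheses (bz : ~ ord_zero b) (SF : F = S b).

Let schreier_transport J : is_isometry (@dual_norm R s X) J ->
  forall A B, S b A -> linked (supports J) A B -> S b B.
Proof. by rewrite -SF => hJ A B; apply: supports_transport. Qed.

Lemma schreier_isometry_diagonal J : is_isometry (@dual_norm R s X) J ->
  diagonal_operator es J.
Proof.
move=> hJ; have [J' [JK J'K hJ']] := dual_isometry_inverse he hJ.
have tJ := schreier_transport hJ; have tJ' := schreier_transport hJ'.
have wJ := supports_wide hJ; have wJ' := supports_wide hJ'.
(* As the support of [J (es i)] is finite, the coordinate i of [J' (J (es i))], equal to 1, is a
   finite sum over k. A nonzero term needs i <= k by [J] and k <= i by [J'], so only k = i can
   contribute. *)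
have diag i : supports J i i.
  apply/negP => /eqP Jii.
  have [l lP] := transport_bounded hW hS tJ i.
  have Jfin m : (l.+1 <= m)%N -> J (es i) (e m) = 0.
    by move=> lm; apply/eqP/negPn/negP => /lP; rewrite leqNgt lm.
  have : J' (J (es i)) (e i) = 0.
    rewrite (finite_expansion Jfin) (isometry_sum hJ') dual_sum big1_fset // => k _ _.
    rewrite (isometryZ hJ') dualZ /=.
    have [->|Jik] := eqVneq (J (es i) (e k)) 0; first by rewrite mul0r.
    have [->|J'ki] := eqVneq (J' (es k) (e i)) 0; first by rewrite mulr0.
    have ik := transport_geq hW hS bz wJ tJ Jik.
    have ki := transport_geq hW hS bz wJ' tJ' J'ki.
    have ik' : k = i by apply/eqP; rewrite eqn_leq ki ik.
    by rewrite ik' Jii eqxx in Jik.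
  by rewrite JK hes eqxx => /eqP; rewrite oner_eq0.
pose omega i := J (es i) (e i).
have JE i : J (es i) = omega i *: es i.
  apply: (dual_ext_basis he) => m; rewrite dualZ hes.
  have [<-|im] := eqVneq i m; first by rewrite mulr1.
  rewrite mulr0; apply/eqP/negPn/negP => Jim.
  by move/eqP: im; apply; apply/esym; apply: (transport_diagonal hW hS wJ tJ).
exists omega; split=> // i.
by rewrite modulusE (eigen_unimodular hJ (JE i)) real_scalar1.
Qed.

End Schreier.

(** * Extremal functionals as unit vectors of l_q *)

Section Disjoint.
Variable J : dual_space X -> dual_space X.
Hypothesis hJ : is_isometry (@dual_norm R s X) J.

Lemma extremal_lpsum_le g B : extremal g -> lpsum q B (g \o e) <= 1.
Proof.
move=> [g1 gF]; pose B' := [fset i in B | g (e i) != 0]%fset.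
have -> : lpsum q B (g \o e) = lpsum q B' (g \o e).
  apply/esym/big_fset_incl; first by apply/fsubsetP => i; rewrite !inE => /andP[].
  move=> i iB; rewrite !inE iB /= negbK => /eqP ->.
  by rewrite modulus0 powR0.
apply: (dual_norm1_lpsum he p1); first by rewrite g1.
by apply: gF => i; rewrite !inE => /andP[].
Qed.

(** Extremality puts [B] in [F], so the l_p sum of v over [B] is at most 1. Dropping the defects
    bounds the l_q sums of g from below; keeping a single one locates a coordinate of an almost
    norming vector. *)
Lemma extremal_young g A B u : extremal g -> vnorm (lin_comb e A u) <= 1 ->
  (forall i, i \in B -> g (e i) != 0) ->
  (forall i, i \in A -> g (e i) != 0 -> i \in B) ->
  exists2 v : nat -> K, (forall i, v i = if i \in A then u i else 0) &
    realpart (g (lin_comb e A u)) + \sum_(i <- B) (modulus (g (e i)) `^ q / q +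
      modulus (v i) `^ p / p - realpart (g (e i) * v i))
    <= lpsum q B (g \o e) / q + p^-1.
Proof.
move=> eg u1 Bg AB; pose v i := if i \in A then u i else 0.
exists v => //.
have FB : F B by apply: eg.2.
have -> : g (lin_comb e A u) = \sum_(i <- B) g (e i) * v i.
  rewrite dual_lin_comb (fsumID A B) [X in _ + X]big1_fset => [|i /fsetDP[iA iB] _].
    rewrite addr0 fsum_restrict; apply: eq_fsum => i iB.
    by rewrite /v; case: ifP; rewrite ?mulr0 // mulrC.
  have [->|gi] := eqVneq (g (e i)) 0; first by rewrite mulr0.
  by rewrite (AB i iA gi) in iB.
rewrite sumrB big_split /= -realpart_sum [X in X <= _]addrC subrK /lpsum -mulr_suml lerD //.
rewrite -mulr_suml -[X in _ <= X]mul1r ler_pM2r //.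
have -> : \sum_(i <- B) modulus (v i) `^ p = lpsum p (A `&` B)%fset u.
  rewrite /lpsum fsum_restrict; apply: eq_bigr => i _.
  by rewrite /v; case: ifP; rewrite // modulus0 powR0.
apply: (vnorm_lin_comb_le1 he p1 _ _ u1); last exact: fsubsetIl.
by apply: hF.2 FB _; apply: fsubsetIr.
Qed.

Lemma extremal_lpsum_gt g eps : extremal g -> 0 < eps ->
  exists B, 1 - eps < lpsum q B (g \o e).
Proof.
move=> eg eps0; have [g1 gF] := eg.
(* An error d in the value of g costs q d in its l_q sum. *)
pose d := Num.min (eps / q) 1.
have d0 : 0 < d by rewrite lt_min divr_gt0 // ltr01.
have [dq d1] : d <= eps / q /\ d <= 1 by rewrite /d !ge_min !lexx orbT.
have [||A [u [u1 gu]]] := @dual_norm_dense _ _ _ _ _ _ he g (1 - d).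
- by rewrite subr_ge0.
- by rewrite g1 ltrBlDr ltrDl.
pose B := [fset i in A | g (e i) != 0]%fset.
have Bg i : i \in B -> g (e i) != 0 by rewrite !inE => /andP[].
have AB i : i \in A -> g (e i) != 0 -> i \in B by rewrite !inE => -> ->.
have [v _ h] := extremal_young eg u1 Bg AB.
exists B; rewrite -(ltr_pM2r qV0) mulrBl mul1r.
have {}h : realpart (g (lin_comb e A u)) <= lpsum q B (g \o e) / q + p^-1.
  apply: le_trans h; rewrite lerDl sumr_ge0 // => i _.
  by rewrite subr_ge0; apply: (young p0 q0 pq).
have := lt_le_trans gu h; rewrite -ltrBlDr; apply: le_lt_trans.
rewrite lerBrDr addrAC -[q^-1 + p^-1]addrC pq lerD2l lerN2.
exact: dq.
Qed.

Lemma extremal_norming g k eps : extremal g -> g (e k) != 0 -> 0 < eps ->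
  exists2 dl, 0 < dl & forall A u, vnorm (lin_comb e A u) <= 1 ->
    1 - dl <= realpart (g (lin_comb e A u)) ->
    modulus ((if k \in A then u k else 0) - dual_scalar q (g (e k))) <= eps.
Proof.
move=> eg gk eps0; have [dl dl0 dlP] := young_modulus p0 q0 pq (g (e k)) eps0.
exists dl => // A u u1 gu; apply: dlP.
(* The index k is included even when [A] misses it; its coordinate is then 0 and the defect at k is
   still bounded. *)
pose B := (k |` [fset i in A | g (e i) != 0])%fset.
have Bg i : i \in B -> g (e i) != 0 by rewrite !inE => /orP[/eqP ->|/andP[]].
have AB i : i \in A -> g (e i) != 0 -> i \in B by rewrite !inE => -> ->; rewrite orbT.
have [v vE h] := extremal_young eg u1 Bg AB; rewrite -vE.
have kB : k \in B by rewrite fset1U1.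
have hB : lpsum q B (g \o e) / q <= q^-1.
  by rewrite -[X in _ <= X]mul1r ler_pM2r // extremal_lpsum_le.
have := le_trans h (lerD hB (lexx p^-1)).
rewrite [q^-1 + p^-1]addrC pq (big_fsetD1 k) //= => h'.
set rest := \sum_(i <- _) _ in h'.
have rest0 : 0 <= rest.
  by apply: sumr_ge0 => i _; rewrite subr_ge0; apply: (young p0 q0 pq).
apply: (@le_trans _ _ (1 - realpart (g (lin_comb e A u)))).
  by rewrite lerBrDl; apply: le_trans h'; rewrite lerD2l lerDl.
by rewrite lerBlDr -lerBlDl.
Qed.

End Disjoint.

End Isometries.

(** * Signed permutations *)

Section Permutation.
Variables (R : realType) (s : scalar_kind).
Local Notation K := (scalar_field R s).
Local Notation modulus := (@modulus R s).
Implicit Types (A B : {fset nat}) (u v : nat -> K).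
Variable X : normedModType K.
Variable e : nat -> X.
Variables (F : set {fset nat}) (p : R).
Hypotheses (hF : combinatorial F) (he : combinatorial_basis e F p) (p1 : 1 < p).
Local Notation q := (p / (p - 1)).

Let p0 : 0 < p. Proof. by apply: lt_trans p1. Qed.
Let pn0 : p != 0. Proof. by rewrite gt_eqF. Qed.
Let q0 : 0 < q. Proof. by rewrite divr_gt0 // subr_gt0. Qed.
Let qn0 : q != 0. Proof. by rewrite gt_eqF. Qed.
Let pq : p^-1 + q^-1 = 1.
Proof. by field; rewrite pn0 subr_eq0 gt_eqF. Qed.

Variable es : nat -> dual_space X.
Hypothesis hes : forall i j, es i (e j) = (i == j)%:R.

Lemma dual_scalarN (a : K) : dual_scalar q (- a) = - dual_scalar q a.
Proof. by rewrite /dual_scalar modulusN invrN mulrN. Qed.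

Section Disjoint.
Variable J : dual_space X -> dual_space X.
Hypothesis hJ : is_isometry (@dual_norm R s X) J.

Lemma extremal_scaled j (c : K) : modulus c = 1 -> extremal e F (c *: J (es j)).
Proof.
move=> c1; have -> : c *: J (es j) = J (dual_comb es [fset j]%fset (fun=> c)).
  by rewrite /dual_comb big_seq_fset1 (isometryZ hJ).
apply: (isometry_extremal hF he p1 hes hJ); first by case: hF.
by rewrite lpsum1 c1 one_powR.
Qed.

(** Members of [F] inside the pair have at most one element, so e_i + c e_j is in the unit ball and
    [es i + c *: es j] takes there the value 1 + c c = 2. A sum near 2 of two terms at most 1 has
    both terms near 1. *)
Lemma norming_pair i j (c : K) eps : i != j -> ~ F [fset i; j]%fset ->
  modulus c = 1 -> c * c = 1 -> 0 < eps ->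
  exists A u, [/\ vnorm (lin_comb e A u) <= 1,
    1 - eps <= realpart (J (es i) (lin_comb e A u))
    & 1 - eps <= realpart ((c *: J (es j)) (lin_comb e A u))].
Proof.
move=> ij nF c1 cc eps0.
pose w k := if k == i then 1 else c.
have mw k : modulus (w k) = 1 by rewrite /w; case: ifP; rewrite ?modulus1.
pose x := lin_comb e [fset i; j]%fset w.
have x1 : vnorm x <= 1.
  apply: (vnorm_lin_comb_le he) => // B FB Bij; rewrite one_powR.
  have [k kB] : exists k, (B `<=` [fset k])%fset.
    have [iB|iB] := boolP (i \in B); last first.
      exists j; apply/fsubsetP => k kB; have := fsubsetP Bij _ kB; rewrite !inE.
      by case/orP => // /eqP ki; rewrite -ki kB in iB.
    exists i; apply/fsubsetP => k kB; have := fsubsetP Bij _ kB; rewrite !inE.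
    case/orP => // /eqP kj; case: nF; suff <- : B = [fset i; j]%fset by [].
    apply/eqP; rewrite eqEfsubset Bij; apply/fsubsetP => l.
    by rewrite !inE => /orP[]/eqP ->; rewrite // -kj.
  by apply: le_trans (lpsum_sub p w kB) _; rewrite lpsum1 mw one_powR.
have f2 : 2 <= dual_norm (es i + c *: es j).
  apply: le_trans (dual_norm_ge _ x1).
  rewrite /x dual_lin_comb big_fsetU1 ?in_fset1 // big_seq_fset1.
  rewrite !dualD !dualZ !hes !eqxx eq_sym (negPf ij) /w eqxx eq_sym (negPf ij).
  rewrite !mulr0 addr0 add0r !mulr1 cc.
  by rewrite -[X in modulus X]/(1 + 1 : K) -(real_scalar1 R s) -real_scalarD
    modulus_real_scalar ger0_norm.
pose d := Num.min eps 1.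
have d0 : 0 < d by rewrite lt_min eps0 ltr01.
have [de d1] : d <= eps /\ d <= 1 by rewrite /d !ge_min !lexx orbT.
have [||A [u [u1]]] := @dual_norm_dense _ _ _ _ _ _ he (J (es i) + c *: J (es j)) (2 - d).
- by lra.
- rewrite -(isometryZ hJ) -(isometryD hJ) (isometryE hJ).
  by apply: lt_le_trans f2; lra.
rewrite dualD realpartD => h; exists A, u.
have le1 g : extremal e F g -> realpart (g (lin_comb e A u)) <= 1.
  move=> [g1 _]; apply: le_trans (realpart_le_modulus _) _.
  by rewrite -g1; apply: dual_norm_ge.
have h1 := le1 _ (isometry_extremal_es hF he p1 hes i hJ).
have h2 := le1 _ (extremal_scaled j c1).
by split=> //; lra.
Qed.

(** The coordinate k of a vector almost norming both functionals is near [dual_scalar q a] and near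
    [dual_scalar q (c * b)]. Using c = 1 and c = -1 makes [dual_scalar q b] its own opposite. *)
Lemma disjoint_nonmember i j k : i != j -> ~ F [fset i; j]%fset ->
  J (es i) (e k) = 0 \/ J (es j) (e k) = 0.
Proof.
move=> ij nF; have [->|a0] := eqVneq (J (es i) (e k)) 0; first by left.
have [->|b0] := eqVneq (J (es j) (e k)) 0; first by right.
exfalso; set a := J (es i) (e k) in a0 *; set b := J (es j) (e k) in b0 *.
have eq_dual c : modulus c = 1 -> c * c = 1 -> dual_scalar q a = dual_scalar q (c * b).
  move=> c1 cc; apply/eqP; rewrite -subr_eq0 -modulus_eq0 eq_le modulus_ge0 andbT.
  apply/ler_addgt0Pr => eps eps0; rewrite add0r.
  have eps2 : 0 < eps / 2 by rewrite divr_gt0.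
  have ei := isometry_extremal_es hF he p1 hes i hJ.
  have ej := extremal_scaled j c1.
  have cb0 : (c *: J (es j)) (e k) != 0.
    by rewrite dualZ mulf_neq0 // -modulus_eq0 c1 oner_eq0.
  have [d1 d10 P1] := extremal_norming hF he p1 ei a0 eps2.
  have [d2 d20 P2] := extremal_norming hF he p1 ej cb0 eps2.
  pose d := Num.min d1 d2.
  have d0 : 0 < d by rewrite lt_min d10.
  have [dd1 dd2] : d <= d1 /\ d <= d2 by rewrite /d !ge_min !lexx orbT.
  have [A [u [u1 h1 h2]]] := norming_pair ij nF c1 cc d0.
  have k1 := P1 A u u1 (le_trans (lerB (lexx _) dd1) h1).
  have k2 := P2 A u u1 (le_trans (lerB (lexx _) dd2) h2).
  set z := if _ then _ else _ in k1 k2.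
  have -> : dual_scalar q a - dual_scalar q (c * b) =
      (z - dual_scalar q (c * b)) - (z - dual_scalar q a) by ring.
  apply: le_trans (modulusD _ _) _; rewrite modulusN.
  have -> : eps = eps / 2 + eps / 2 by field.
  exact: lerD k2 k1.
have h1 := eq_dual 1 (modulus1 R s) (mulr1 1).
have h2 := eq_dual (-1) (etrans (modulusN _) (modulus1 R s)) (etrans (mulrNN _ _) (mulr1 _)).
have := dual_scalar_neq0 p0 q0 pq b0.
rewrite mul1r in h1; rewrite mulN1r dual_scalarN -h1 in h2.
by rewrite -h1 -eqNr -h2 eqxx.
Qed.

Lemma disjoint_member i j k : p != 2 -> i != j -> F [fset i; j]%fset ->
  J (es i) (e k) = 0 \/ J (es j) (e k) = 0.
Proof.
move=> p2 ij Fij; have [->|a0] := eqVneq (J (es i) (e k)) 0; first by left.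
have [->|b0] := eqVneq (J (es j) (e k)) 0; first by right.
exfalso; set f := J (es i) in a0 *; set g := J (es j) in b0 *.
(* With t^q = 1/2 both t (es i + es j) and t (es i - es j) lie on the l_q sphere over the pair. *)
pose t : R := 2^-1 `^ q^-1; have tq : t `^ q = 2^-1 by rewrite powRVK.
have t0 : 0 < t by rewrite powR_gt0 // invr_gt0.
pose c := real_scalar s t.
have mc : modulus c `^ q = 2^-1 by rewrite modulus_real_scalar ger0_norm ?tq // ltW.
have c0 : c != 0 by rewrite -modulus_eq0 modulus_real_scalar gtr0_norm // gt_eqF.
have ext (w : K) : modulus w = 1 -> extremal e F (c *: f + (w * c) *: g).
  move=> w1; pose a l := if l == i then c else w * c.
  have -> : c *: f + (w * c) *: g = J (dual_comb es [fset i; j]%fset a).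
    rewrite /dual_comb big_fsetU1 ?in_fset1 //= big_seq_fset1 /a eqxx eq_sym (negPf ij).
    by rewrite (isometryD hJ) !(isometryZ hJ).
  apply: (isometry_extremal hF he p1 hes hJ) => //.
  rewrite /lpsum big_fsetU1 ?in_fset1 //= big_seq_fset1 /a eqxx eq_sym (negPf ij).
  by rewrite modulusM w1 mul1r mc; lra.
have ep := ext 1 (modulus1 R s).
have em := ext (-1) (etrans (modulusN _) (modulus1 R s)).
set gp := c *: f + _ in ep; set gm := c *: f + _ in em.
have ef := isometry_extremal_es hF he p1 hes i hJ.
have eg := isometry_extremal_es hF he p1 hes j hJ.
pose x l := c * f (e l); pose y l := c * g (e l).
have gpE l : gp (e l) = x l + y l by rewrite dualD !dualZ mul1r.
have gmE l : gm (e l) = x l - y l by rewrite dualD !dualZ mulN1r mulNr.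
have xE l : 2 * modulus (x l) `^ q = modulus (f (e l)) `^ q.
  by rewrite modulusM powRM ?modulus_ge0 // mc mulrA mulfV ?mul1r // pnatr_eq0.
have yE l : 2 * modulus (y l) `^ q = modulus (g (e l)) `^ q.
  by rewrite modulusM powRM ?modulus_ge0 // mc mulrA mulfV ?mul1r // pnatr_eq0.
have fgE l : modulus (f (e l)) `^ q + modulus (g (e l)) `^ q =
    2 * (modulus (x l) `^ q + modulus (y l) `^ q) by rewrite mulrDr xE yE.
have x0 : x k != 0 by rewrite mulf_neq0.
have y0 : y k != 0 by rewrite mulf_neq0.
(* The l_q-norms of f, g and gp, gm are all 1, so Clarkson's inequality, which is
   strict at k, cannot hold termwise. *)
have absurd (f1 g1 f2 g2 : dual_space X) :
    extremal e F f1 -> extremal e F g1 -> extremal e F f2 -> extremal e F g2 ->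
    (forall l, modulus (f1 (e l)) `^ q + modulus (g1 (e l)) `^ q <=
       modulus (f2 (e l)) `^ q + modulus (g2 (e l)) `^ q) ->
    modulus (f1 (e k)) `^ q + modulus (g1 (e k)) `^ q <
       modulus (f2 (e k)) `^ q + modulus (g2 (e k)) `^ q -> False.
  move=> e1 e1' e2 e2' le lt.
  (* Half the gap at k: the l_q sums of f1 and g1 fall short of 1 by less than dl each, so the gap 2
     dl would lift those of f2 and g2 above 2 in total. *)
  pose dl := (modulus (f2 (e k)) `^ q + modulus (g2 (e k)) `^ q -
    (modulus (f1 (e k)) `^ q + modulus (g1 (e k)) `^ q)) / 2.
  have dl0 : 0 < dl by rewrite divr_gt0 // subr_gt0.
  have [B1 h1] := extremal_lpsum_gt hF he p1 e1 dl0.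
  have [B2 h2] := extremal_lpsum_gt hF he p1 e1' dl0.
  pose B := (k |` (B1 `|` B2))%fset.
  have B1B : (B1 `<=` B)%fset by apply/fsubsetP => l lB; rewrite !inE lB orbT.
  have B2B : (B2 `<=` B)%fset by apply/fsubsetP => l lB; rewrite !inE lB !orbT.
  have {}h1 := lt_le_trans h1 (lpsum_sub q (f1 \o e) B1B).
  have {}h2 := lt_le_trans h2 (lpsum_sub q (g1 \o e) B2B).
  have h3 := extremal_lpsum_le he p1 B e2.
  have h4 := extremal_lpsum_le he p1 B e2'.
  have kB : k \in B by rewrite fset1U1.
  have : lpsum q B (f1 \o e) + lpsum q B (g1 \o e) + 2 * dl <=
      lpsum q B (f2 \o e) + lpsum q B (g2 \o e).
    rewrite /lpsum -!big_split /= (big_fsetD1 k) //= [X in _ <= X](big_fsetD1 k) //=.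
    rewrite [X in X <= _]addrAC; apply: lerD; last by apply: ler_sum.
    by rewrite /dl [2 * _]mulrC divfK ?pnatr_eq0 // addrC subrK.
  move: h1 h2 h3 h4; lra.
have q2 : q != 2.
  apply/negP => /eqP q2; move/negP: p2; apply; apply/eqP.
  have := pq; rewrite q2 => h; have : p^-1 = 2^-1 by lra.
  by move/invr_inj.
(* Clarkson's inequality reverses at q = 2, so the two pairs exchange their roles. *)
have [q2'|q2'|q2'] := ltgtP q 2; last by rewrite q2' eqxx in q2.
  have q02 : 0 < q < 2 by rewrite q0.
  apply: (absurd gp gm f g) => // [l|]; rewrite gpE gmE fgE.
    exact: (@clarkson_lt2 R s q (x l) (y l) q02).
  exact: (@clarkson_lt2_lt R s q (x k) (y k) q02).
apply: (absurd f g gp gm) => // [l|]; rewrite gpE gmE fgE.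
  exact: (@clarkson_gt2 R s q (x l) (y l) q2').
exact: (@clarkson_gt2_lt R s q (x k) (y k) q2').
Qed.

Lemma isometry_disjoint i j k : p != 2 -> i != j ->
  J (es i) (e k) = 0 \/ J (es j) (e k) = 0.
Proof.
move=> p2 ij; have [Fij|Fij] := pselect (F [fset i; j]%fset).
  exact: disjoint_member.
exact: disjoint_nonmember.
Qed.

End Disjoint.

(** Take k in the support of f = J (es i), and l different from i. Applying J' to the truncations of
    f approximates es i, which vanishes at e_l. If J' (es k) did not vanish there, disjointness for
    J' would leave only the fixed nonzero term m = k. So J' (es k) is a multiple of es i. *)
Lemma isometry_maps_basis J i : p != 2 -> is_isometry (@dual_norm R s X) J ->
  exists k (c : K), modulus c = 1 /\ J (es i) = c *: es k.
Proof.
move=> p2 hJ; have [J' [JK J'K hJ']] := dual_isometry_inverse he hJ.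
pose f := J (es i).
have f1 : dual_norm f = 1 by rewrite (isometryE hJ) (dual_norm_es hF he p1 hes).
have [k fk] : exists k, f (e k) != 0.
  apply: contrapT => nk; have : f = 0.
    apply: (dual_ext_basis he) => k; apply/eqP/negPn/negP => fk.
    by apply: nk; exists k.
  by move=> f0; move: f1; rewrite f0 dual_norm0 => /eqP; rewrite eq_sym oner_eq0.
have g0 l : l != i -> J' (es k) (e l) = 0.
  move=> li; apply/eqP/negPn/negP => gkl.
  have small eps : 0 < eps -> modulus (f (e k) * J' (es k) (e l)) <= eps.
    move=> eps0; have [n0 n0P] := partial_dual_cvg hF he p1 hes f eps0.
    pose n := maxn n0 k.+1.
    have {n0P} h := n0P n (leq_maxl _ _).
    have kn : k \in below n by rewrite in_below leq_maxr.
    apply: le_trans h; rewrite -(isometryE hJ') (isometryB hJ') JK.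
    apply: le_trans (dual_norm_coord he _ l).
    rewrite dualB hes eq_sym (negPf li) sub0r modulusN.
    rewrite (isometry_sum hJ') dual_sum (big_fsetD1 k) // big1_fset.
      by rewrite (isometryZ hJ') dualZ -[X in _ <= modulus X]/(_ + 0) addr0.
    move=> m /fsetD1P[mk _] _; rewrite (isometryZ hJ') dualZ.
    have [->|h'] := isometry_disjoint hJ' l p2 mk; first by rewrite mulr0.
    by rewrite h' eqxx in gkl.
  have : 0 < modulus (f (e k) * J' (es k) (e l)).
    by rewrite modulus_gt0 mulf_neq0.
  move=> m0; have := small _ (divr_gt0 m0 (ltr0n _ 2)); lra.
pose c := J' (es k) (e i).
have J'E : J' (es k) = c *: es i.
  apply: (dual_ext_basis he) => l; rewrite dualZ hes.
  have [<-|il] := eqVneq i l; first by rewrite mulr1.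
  by rewrite mulr0 g0 // eq_sym.
have c1 := eigen_unimodular hF he p1 hes hJ' J'E.
have c0 : c != 0 by rewrite -modulus_eq0 c1 oner_eq0.
exists k, c^-1; split; first by rewrite modulusV c1 invr1.
by rewrite -[es k]J'K J'E (isometryZ hJ) scalerA mulVf // scale1r.
Qed.

Theorem dual_isometry_signed_permutation J : p != 2 ->
  is_isometry (@dual_norm R s X) J -> compatible_signed_permutation F es J.
Proof.
move=> p2 hJ; have [J' [JK J'K hJ']] := dual_isometry_inverse he hJ.
have [pi /choice[om piP]] := choice (fun i => isometry_maps_basis i p2 hJ).
have [pi' /choice[om' pi'P]] := choice (fun i => isometry_maps_basis i p2 hJ').
have neq0 (c : K) : modulus c = 1 -> c != 0.
  by move=> c1; rewrite -modulus_eq0 c1 oner_eq0.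
have es_inj i k (c : K) : c != 0 -> es i = c *: es k -> i = k.
  move=> c0 /(congr1 (fun h : dual_space X => h (e k))); rewrite dualZ !hes eqxx mulr1.
  by case: eqP => // _ /esym/eqP; rewrite (negPf c0).
have piK : cancel pi pi'.
  move=> i; have [c1 Ji] := piP i; have [c1' J'pi] := pi'P (pi i).
  apply/esym; apply: (es_inj _ _ (om i * om' (pi i))).
    by rewrite mulf_neq0 ?neq0.
  by rewrite -{1}[es i]JK Ji (isometryZ hJ') J'pi scalerA.
have pi'K : cancel pi' pi.
  move=> i; have [c1 Ji] := pi'P i; have [c1' J'pi] := piP (pi' i).
  apply/esym; apply: (es_inj _ _ (om' i * om (pi' i))).
    by rewrite mulf_neq0 ?neq0.
  by rewrite -{1}[es i]J'K Ji (isometryZ hJ) J'pi scalerA.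
(* The images have one-point supports, so transport along them says that the permutation maps [F]
   into itself; used for [J] and [J'], it gives both inclusions. *)
have image T sg c A : is_isometry (@dual_norm R s X) T ->
    (forall i, modulus (c i) = 1 /\ T (es i) = c i *: es (sg i)) ->
    F A -> F [fset sg i | i in A]%fset.
  move=> hT sgP FA; apply: (supports_transport hF he p1 hes hT FA).
  move=> _ /imfsetP[i /= iA ->]; exists i => //; have [c1 Ti] := sgP i.
  by rewrite /supports Ti dualZ hes eqxx mulr1 neq0.
exists om, pi; split.
- by move=> i; rewrite modulusE (piP i).1 real_scalar1.
- by exists pi'.
- apply/seteqP; split=> [_ [A FA <-]|A FA]; first exact: image piP FA.
  exists [fset pi' i | i in A]%fset; first exact: image pi'P FA.
  apply/fsetP => i; apply/imfsetP/idP => [[_ /imfsetP[j /= jA ->] ->]|iA].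
    by rewrite pi'K.
  by exists (pi' i); [rewrite in_imfset | rewrite pi'K].
- by move=> i; apply: (piP i).2.
Qed.

End Permutation.

(** * Completions and adjoints *)

Section Completion.
Variables (R : realType) (s : scalar_kind).
Local Notation K := (scalar_field R s).

Lemma c00_combE (A : {fset nat}) (u : nat -> K) j :
  (\sum_(i <- A) u i *: c00_basis K i : c00 K) j = if j \in A then u j else 0.
Proof.
have -> : (\sum_(i <- A) u i *: c00_basis K i : c00 K) j =
    \sum_(i <- A) u i * (j == i)%:R.
  by elim/big_ind2: _ => // x y z t <- <-.
case: ifP => jA.
  rewrite (big_fsetD1 j) //= eqxx mulr1 big1_fset ?addr0 // => i.
  by rewrite eq_sym => /fsetD1P[/negPf -> _] _; rewrite mulr0.
rewrite big1_fset // => i iA _; case: eqP => [ji|]; rewrite ?mulr0 //.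
by rewrite -ji jA in iA.
Qed.

Variables (F : set {fset nat}) (p : R) (X : completeNormedModType K).
Variable iota : {linear c00 K -> X}.
Hypotheses (hF : combinatorial F) (p1 : 1 < p) (hX : is_completion F p iota).

Lemma completion_basis : combinatorial_basis (unit_vector iota) F p.
Proof.
have p0 : 0 < p by apply: lt_trans p1.
have pn0 : p != 0 by rewrite gt_eqF.
have pV0 : 0 < p^-1 by rewrite invr_gt0.
have [isoX densX] := hX.
pose c (A : {fset nat}) (u : nat -> K) : c00 K := \sum_(i <- A) u i *: c00_basis K i.
have lcE A u : lin_comb (unit_vector iota) A u = iota (c A u).
  by rewrite /c linear_sum; apply: eq_bigr => i _; rewrite linearZ.
have sumE A u (B : {fset nat}) : \sum_(i <- B) realpart `|c A u i| `^ p =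
    lpsum p (A `&` B)%fset u.
  rewrite /lpsum fsum_restrict; apply: eq_bigr => i _; rewrite c00_combE.
  case: ifP => // _; rewrite -[realpart `|_|]/(modulus 0) modulus0 powR0 //.
have normE A u : vnorm (lin_comb (unit_vector iota) A u) =
    sup [set lpsum p (A `&` B)%fset u `^ p^-1 | B in F].
  rewrite lcE isoX /family_norm; apply: (congr1 sup).
  by apply: eq_imagel => B _; rewrite sumE.
have hsup (A : {fset nat}) (u : nat -> K) :
    has_sup [set lpsum p (A `&` B)%fset u `^ p^-1 | B in F].
  split.
    exists (lpsum p (A `&` [fset 0%N])%fset u `^ p^-1), [fset 0%N]%fset => //.
    by case: hF.
  exists (lpsum p A u `^ p^-1) => _ [B FB <-].
  by rewrite powR_le ?lpsum_ge0 ?(ltW pV0) // lpsum_sub // fsubsetIl.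
split.
- move=> A B u FB /fsetIidPr BA; rewrite -{1}BA -[X in X <= _](@powRVK _ p) ?lpsum_ge0 //.
  rewrite powR_le ?powR_ge0 ?(ltW p0) // normE.
  by apply: sup_upper_bound; [exact: hsup | exists B].
- move=> A u r r0 h; rewrite normE; apply: ge_sup; first by case: (hsup A u).
  move=> _ [B FB <-]; rewrite -[X in _ <= X](@powRK _ p) //.
  rewrite powR_le ?lpsum_ge0 ?(ltW pV0) //; apply: h; last exact: fsubsetIl.
  by apply: hF.2 FB _; apply: fsubsetIr.
- move=> x eps eps0.
  have e0 : 0 < real_scalar s eps by rewrite -(real_scalar0 R s) real_scalar_lt.
  have [||z [xz [y _ yz]]] := densX (ball x (real_scalar s eps)).
  + by exists x; apply: ballxx.
  + exact: ball_open.
  have /asboolP fy := c00_valP y.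
  pose A := fset_set [set i | y i != 0].
  have cy : c A y = y :> c00 K.
    apply/val_inj/funext => j; rewrite /= -/(c00_val _ j) c00_combE in_fset_set //.
    case: ifPn => //; rewrite notin_setE /= => /negP; rewrite negbK => /eqP yj.
    exact/esym.
  exists A, y; rewrite lcE cy.
  by move: xz; rewrite -yz -ball_normE /= vnormE real_scalar_lt.
Qed.

End Completion.

(** * Existence of the coordinate functionals on the completion *)

Section CoordinateFunctionals.
Variables (R : realType) (s : scalar_kind).
Local Notation K := (scalar_field R s).
Local Notation modulus := (@modulus R s).
Variable X : normedModType K.
Variable e : nat -> X.
Variables (F : set {fset nat}) (p : R).
Hypotheses (hF : combinatorial F) (he : combinatorial_basis e F p) (p1 : 1 < p).

(** The limit is the supremum of the lower ends c n - 1/(n+1), all of which lie below every upper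
    end. *)
Lemma real_cauchy_limit (c : nat -> R) :
  (forall n m, `|c n - c m| <= n.+1%:R^-1 + m.+1%:R^-1) ->
  exists l, forall n, `|c n - l| <= n.+1%:R^-1.
Proof.
move=> hc; pose S := [set c n - n.+1%:R^-1 | n in [set: nat]].
have ub m : ubound S (c m + m.+1%:R^-1).
  move=> _ [n _ <-]; rewrite lerBlDr -addrA [_^-1 + _]addrC -lerBlDl.
  exact: le_trans (ler_norm _) (hc n m).
have hS : has_sup S.
  by split; [exists (c 0%N - 1%:R^-1), 0%N | exists (c 0%N + 1%:R^-1); exact: ub].
exists (sup S) => n; rewrite ler_distlC; apply/andP; split.
  by apply: sup_upper_bound => //; exists n.
by apply: ge_sup; [case: hS | exact: ub].
Qed.

Lemma sqrt_sum_sqr_le (a b : R) : Num.sqrt (a ^+ 2 + b ^+ 2) <= `|a| + `|b|.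
Proof.
have ab0 : 0 <= `|a| + `|b| by rewrite addr_ge0.
rewrite -[X in _ <= X](ger0_norm ab0) -[X in _ <= X]sqrtr_sqr ler_wsqrtr //.
rewrite sqrrD !real_normK ?num_real // addrAC lerDl.
by rewrite mulrn_wge0 // mulr_ge0.
Qed.

Lemma scalar_cauchy_limit (c : nat -> K) :
  (forall n m, modulus (c n - c m) <= n.+1%:R^-1 + m.+1%:R^-1) ->
  exists l, forall n, modulus (c n - l) <= 2 * n.+1%:R^-1.
Proof.
case: (s) c => c hc.
  have [l lP] := real_cauchy_limit hc; exists l => n.
  by apply: le_trans (lP n) _; rewrite ler_peMl // ler1n.
have [n m|a aP] := @real_cauchy_limit (fun n => complex.Re (c n)).
  apply: le_trans (hc n m); rewrite /modulus.
  case: (c n) (c m) => [x y] [z t] /=; rewrite -sqrtr_sqr ler_wsqrtr //.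
  by rewrite lerDl sqr_ge0.
have [n m|b bP] := @real_cauchy_limit (fun n => complex.Im (c n)).
  apply: le_trans (hc n m); rewrite /modulus.
  case: (c n) (c m) => [x y] [z t] /=; rewrite -sqrtr_sqr ler_wsqrtr //.
  by rewrite lerDr sqr_ge0.
exists (Complex a b) => n; rewrite mulr_natl mulr2n.
apply: le_trans (lerD (aP n) (bP n)); rewrite /modulus.
by case: (c n) => [x y] /=; apply: sqrt_sum_sqr_le.
Qed.

Definition coef (A : {fset nat}) (u : nat -> K) (k : nat) : K :=
  if k \in A then u k else 0.

Lemma lin_comb_coef (A B : {fset nat}) u : (A `<=` B)%fset ->
  lin_comb e B (coef A u) = lin_comb e A u.
Proof.
move=> AB; rewrite (lin_combID _ _ A) (fsetIidPr AB) (@eq_lin_comb _ _ _ _ A _ u).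
  rewrite [X in _ + X]big1_fset ?addr0 // => i /fsetDP[_ /negPf iA] _.
  by rewrite /coef iA scale0r.
by move=> i; rewrite /coef => ->.
Qed.

Lemma lin_comb_linear (A B : {fset nat}) u v (a : K) :
  exists C w, lin_comb e C w = a *: lin_comb e A u + lin_comb e B v /\
    forall k, coef C w k = a * coef A u k + coef B v k.
Proof.
exists (A `|` B)%fset, (fun i => a * coef A u i + coef B v i); split.
  by rewrite lin_combD lin_combZ !lin_comb_coef ?fsubsetUl ?fsubsetUr.
move=> k; rewrite {1}/coef; case: ifPn => //; rewrite in_fsetU negb_or /coef.
by move=> /andP[/negPf -> /negPf ->]; rewrite mulr0 addr0.
Qed.

Lemma modulus_coef_le A u k : modulus (coef A u k) <= vnorm (lin_comb e A u).
Proof.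
rewrite /coef; case: ifP => kA; last by rewrite modulus0 vnorm_ge0.
exact: (modulus_le_vnorm hF he p1).
Qed.

Lemma coef_dist A B u v k :
  modulus (coef A u k - coef B v k) <= vnorm (lin_comb e A u - lin_comb e B v).
Proof.
have [C [w [lw wk]]] := lin_comb_linear B A v u (-1).
have := modulus_coef_le C w k; rewrite lw wk scaleN1r mulN1r.
by rewrite [X in vnorm X]addrC [X in modulus X]addrC.
Qed.

Let approx (x : X) eps : 0 < eps -> exists A u, vnorm (x - lin_comb e A u) < eps.
Proof. by case: he => _ _ h; apply: h. Qed.

(** Describes the k-th coordinate of x without limits: density leaves room for one such l only, and
    the empty combination gives |l| <= ||x||. *)
Definition is_coord (k : nat) (x : X) (l : K) : Prop :=
  forall A u, modulus (coef A u k - l) <= vnorm (x - lin_comb e A u).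

Lemma vnorm_sub_trans (x y z : X) : vnorm (x - z) <= vnorm (x - y) + vnorm (y - z).
Proof. by have := vnormD (x - y) (y - z); rewrite addrA subrK. Qed.

Lemma modulus_sub_trans (x y z : K) : modulus (x - z) <= modulus (x - y) + modulus (y - z).
Proof. by have := modulusD (x - y) (y - z); rewrite addrA subrK. Qed.

Lemma is_coord_exists k x : exists l, is_coord k x l.
Proof.
have ap n : exists Au : {fset nat} * (nat -> K),
    vnorm (x - lin_comb e Au.1 Au.2) < n.+1%:R^-1.
  have n0 : 0 < n.+1%:R^-1 :> R by rewrite invr_gt0 ltr0n.
  by have [A [u h]] := approx x n0; exists (A, u).
have [Au AuP] := choice ap.
have [n m|l lP] := @scalar_cauchy_limit (fun n => coef (Au n).1 (Au n).2 k).
  apply: le_trans (coef_dist _ _ _ _ _) _.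
  apply: le_trans (vnorm_sub_trans _ x _) _; rewrite vnormBC.
  by apply: lerD; apply: ltW.
exists l => A u; apply/ler_addgt0Pr => eps eps0.
pose n := Num.truncn (3 / eps).
have n3 : 3 * n.+1%:R^-1 <= eps.
  rewrite ler_pdivrMr ?ltr0n // mulrC -ler_pdivrMr // ltW //.
  exact: truncnS_gt.
apply: le_trans (modulus_sub_trans _ (coef (Au n).1 (Au n).2 k) _) _.
have h1 : modulus (coef (Au n).1 (Au n).2 k - l) <= 2 * n.+1%:R^-1 := lP n.
have h2 := coef_dist A (Au n).1 u (Au n).2 k.
have h3 := vnorm_sub_trans (lin_comb e A u) x (lin_comb e (Au n).1 (Au n).2).
rewrite [X in _ <= X + _]vnormBC in h3.
have h4 : vnorm (x - lin_comb e (Au n).1 (Au n).2) < n.+1%:R^-1 := AuP n.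
by move: n.+1%:R^-1 n3 h1 h4 => t n3 h1 h4; lra.
Qed.

Lemma is_coord_unique k x l l' : is_coord k x l -> is_coord k x l' -> l = l'.
Proof.
move=> h h'; apply/eqP; rewrite -subr_eq0 -modulus_eq0 eq_le modulus_ge0 andbT.
apply/ler_addgt0Pr => eps eps0; rewrite add0r.
have eps2 : 0 < eps / 2 by rewrite divr_gt0.
have [A [u xu]] := approx x eps2.
have := modulus_sub_trans l (coef A u k) l'; rewrite [modulus (l - coef _ _ _)]modulusBC.
have := h A u; have := h' A u; lra.
Qed.

Lemma is_coord_linear k x y l m (a : K) : is_coord k x l -> is_coord k y m ->
  is_coord k (a *: x + y) (a * l + m).
Proof.
move=> hx hy A u; apply/ler_addgt0Pr => eps eps0.
(* The approximation errors add up to (|a| + 1) eps / M = eps / 2, and this enters twice. *)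
pose M := 2 * (modulus a + 1).
have M0 : 0 < M by rewrite mulr_gt0 // ltr_wpDl // modulus_ge0.
have d0 : 0 < eps / M by rewrite divr_gt0.
have [B [v xv]] := approx x d0; have [C [w yw]] := approx y d0.
have [D [z [zE zk]]] := lin_comb_linear B C v w a.
have h1 := coef_dist A D u z k.
have h2 := vnorm_sub_trans (lin_comb e A u) (a *: x + y) (lin_comb e D z).
rewrite [X in _ <= X + _]vnormBC in h2.
have h3 : vnorm (a *: x + y - lin_comb e D z) <= modulus a * (eps / M) + eps / M.
  rewrite zE opprD addrACA -scalerBr; apply: le_trans (vnormD _ _) _.
  by rewrite vnormZ lerD ?ler_wpM2l ?modulus_ge0 // ltW.
have h4 : modulus (coef D z k - (a * l + m)) <= modulus a * (eps / M) + eps / M.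
  rewrite zk opprD addrACA -mulrBr; apply: le_trans (modulusD _ _) _.
  rewrite modulusM lerD ?ler_wpM2l ?modulus_ge0 //.
    by apply: le_trans (hx B v) _; apply: ltW.
  by apply: le_trans (hy C w) _; apply: ltW.
have epsE : eps = 2 * (modulus a * (eps / M) + eps / M).
  rewrite -[X in _ + X]mul1r -mulrDl mulrA -/M mulrC divfK // gt_eqF //.
have := modulus_sub_trans (coef A u k) (coef D z k) (a * l + m); lra.
Qed.

(** Serves the statements on isometries of [X] itself, where no coordinate functionals are given. *)
Lemma coordinate_functionals_exist :
  exists es : nat -> dual_space X, forall i j, es i (e j) = (i == j)%:R.
Proof.
have [c cP] := choice (fun kx : nat * X => is_coord_exists kx.1 kx.2).
have c_linear k : linear (fun x => c (k, x) : K^o).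
  move=> a x y; apply: (is_coord_unique (cP (k, a *: x + y))).
  exact: is_coord_linear (cP (k, x)) (cP (k, y)).
have c_bounded k x : modulus (c (k, x)) <= 1 * vnorm x.
  have := cP (k, x) fset0 (fun=> 0).
  by rewrite /coef in_fset0 sub0r modulusN /lin_comb big_seq_fset0 subr0 mul1r.
exists (fun k => Dual (bounded_continuous_form (c_linear k) (c_bounded k))).
move=> i j; apply/eqP; rewrite -subr_eq0 -modulus_eq0 eq_le modulus_ge0 andbT.
have := cP (i, e j) [fset j]%fset (fun=> 1).
rewrite /lin_comb big_seq_fset1 scale1r subrr vnorm0 modulusBC /coef in_fset1 /=.
by case: eqP.
Qed.

End CoordinateFunctionals.

(** * Passage from the dual back to the space *)

Section Adjoint.
Variables (R : realType) (s : scalar_kind).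
Local Notation K := (scalar_field R s).
Local Notation modulus := (@modulus R s).
Variable X : normedModType K.
Variable e : nat -> X.
Variables (F : set {fset nat}) (p : R).
Hypotheses (hF : combinatorial F) (he : combinatorial_basis e F p) (p1 : 1 < p).
Variable es : nat -> dual_space X.
Hypothesis hes : forall i j, es i (e j) = (i == j)%:R.

(** A finite combination z near x is normed by functionals [dual_comb B b] of the dual ball, which
    vanish at x. Hence ||z|| <= ||z - x|| and ||x|| <= 2 ||x - z||. *)
Lemma coordinates_separate (x : X) : (forall i, es i x = 0) -> x = 0.
Proof.
have p0 : 0 < p by apply: lt_trans p1.
have pn0 : p != 0 by rewrite gt_eqF.
move=> x0; apply: vnorm0_eq0; apply/le_anti; rewrite vnorm_ge0 andbT.
apply/ler_addgt0Pr => eps eps0; rewrite add0r.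
have eps2 : 0 < eps / 2 by rewrite divr_gt0.
have [A [u xu]] : exists A u, vnorm (x - lin_comb e A u) < eps / 2.
  by case: he => _ _ h; apply: h.
have : vnorm (lin_comb e A u) <= vnorm (lin_comb e A u - x).
  apply: (vnorm_lin_comb_le he) => [|B FB BA]; first exact: vnorm_ge0.
  have := lpsum_ge0 p B u; rewrite le_eqVlt => /predU1P[<-|S0]; first exact: powR_ge0.
  have [b b1 bu] := norming_coefficients p1 S0.
  have hb : dual_norm (dual_comb es B b) <= 1.
    by apply: (dual_norm_comb hF he p1 hes) => //; rewrite b1.
  have := dual_normP (dual_comb es B b) (lin_comb e A u - x).
  have -> : dual_comb es B b (lin_comb e A u - x) =
      real_scalar s (lpsum p B u `^ p^-1).
    rewrite dual_sub (dual_comb_lin_comb hes) (fsetIidPl BA) -bu.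
    have -> : dual_comb es B b x = 0.
      by rewrite dual_sum big1_fset // => i _ _; rewrite dualZ x0 mulr0.
    by rewrite subr0; apply: eq_bigr => i _; rewrite mulrC.
  rewrite modulus_real_scalar ger0_norm ?powR_ge0 // => h.
  rewrite -[X in X <= _](@powRVK _ p) ?lpsum_ge0 //.
  rewrite powR_le ?powR_ge0 ?(ltW p0) //; apply: le_trans h _.
  by rewrite ler_piMl ?vnorm_ge0.
have := vnormD (x - lin_comb e A u) (lin_comb e A u); rewrite subrK vnormBC.
rewrite vnormBC in xu; lra.
Qed.

Lemma adjoint_isometry (J : X -> X) : is_isometry (@vnorm R s X) J ->
  exists T : dual_space X -> dual_space X,
    is_isometry (@dual_norm R s X) T /\ forall f x, T f x = f (J x).
Proof.
move=> hJ; have [J' [JK J'K hJ']] :=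
  isometry_inverse hJ (@vnorm0_eq0 R s X) (vnorm0 X).
have pullback I : is_isometry (@vnorm R s X) I ->
    exists T : dual_space X -> dual_space X, forall f x, T f x = f (I x).
  move=> hI; suff h (f : dual_space X) :
      exists g : dual_space X, forall x, g x = f (I x).
    by have [T TE] := choice h; exists T.
  have lin : linear (fun x => f (I x)).
    by move=> a x y /=; rewrite (isometryD hI) (isometryZ hI); apply: dual_linear.
  have bnd x : modulus (f (I x)) <= dual_norm f * vnorm x.
    by rewrite -(isometryE hI x); apply: dual_normP.
  by exists (Dual (bounded_continuous_form lin bnd)).
have [T TE] := pullback J hJ; have [T' T'E] := pullback J' hJ'.
exists T; split=> //; split.
- by move=> a f g; apply: dual_ext => x; rewrite TE !dualD !dualZ !TE.
- by move=> f; exists (T' f); apply: dual_ext => x; rewrite TE T'E JK.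
- move=> f; congr sup; apply/seteqP; split=> _ [x /= x1 <-].
    by exists (J x); rewrite /= ?TE ?(isometryE hJ).
  by exists (J' x); rewrite /= ?TE ?J'K ?(isometryE hJ').
Qed.

(** The matrix of [J] is the transpose of that of its adjoint, which inverts the permutation;
    comparing coordinates is enough because they separate points. *)
Lemma adjoint_basis (J : X -> X) (T : dual_space X -> dual_space X) (om : nat -> K)
    (pi pi' : nat -> nat) :
  (forall f x, T f x = f (J x)) -> cancel pi pi' -> cancel pi' pi ->
  (forall i, T (es i) = om i *: es (pi i)) ->
  forall k, J (e k) = om (pi' k) *: e (pi' k).
Proof.
move=> TE piK pi'K Tes k; apply/eqP; rewrite -subr_eq0; apply/eqP.
apply: coordinates_separate => i; rewrite dual_sub -TE Tes dualZ dual_scale !hes.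
rewrite -(inj_eq (can_inj piK) i (pi' k)) pi'K.
by case: eqP => [<-|]; rewrite ?piK ?mulr0 ?subrr.
Qed.

Lemma signed_permutation_adjoint (J : X -> X) (T : dual_space X -> dual_space X) :
   (forall f x, T f x = f (J x)) ->
  compatible_signed_permutation F es T -> compatible_signed_permutation F e J.
Proof.
move=> TE [om [pi [om1 [pi' piK pi'K] piF Tes]]].
exists (om \o pi'), pi'; split.
- by move=> i; apply: om1.
- by exists pi.
- have image (A : {fset nat}) : [fset pi' j | j in [fset pi i | i in A]]%fset = A.
    apply/fsetP => i; apply/imfsetP/idP => [[_ /imfsetP[j /= jA ->] ->]|iA].
      by rewrite piK.
    by exists (pi i); [rewrite in_imfset | rewrite piK].
  apply/seteqP; split=> [_ [A FA <-]|A FA].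
    by move: FA; rewrite -{1}piF => -[B FB <-]; rewrite image.
  exists [fset pi i | i in A]%fset; last exact: image.
  by rewrite -piF; exists A.
- exact: adjoint_basis TE piK pi'K Tes.
Qed.

Lemma diagonal_adjoint (J : X -> X) (T : dual_space X -> dual_space X) :
   (forall f x, T f x = f (J x)) ->
  diagonal_operator es T -> diagonal_operator e J.
Proof.
move=> TE [om [om1 Tes]]; exists om; split=> //.
by apply: (adjoint_basis (pi := id) TE).
Qed.

End Adjoint.

Unset Implicit Arguments.

Theorem theorem1p1 (R : realType) (s : scalar_kind) (p : R) (hp : 1 < p) :
  (forall F : set {fset nat}, combinatorial F -> p != 2 ->
     forall (X : completeNormedModType (scalar_field R s))
            (iota : {linear c00 (scalar_field R s) -> X}),
     is_completion F p iota ->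
     (forall es : nat -> dual_space X, coordinate_functionals iota es ->
        forall J : dual_space X -> dual_space X, is_isometry (@dual_norm R s X) J ->
        compatible_signed_permutation F es J) /\
     (forall J : X -> X, is_isometry (@vnorm R s X) J ->
        compatible_signed_permutation F (unit_vector iota) J))
  /\
  (forall (d : Order.disp_t) (W : orderType d)
          (S : W -> set {fset nat}) (approx : W -> nat -> W),
     is_omega1 W -> transfinite_schreier S approx ->
     (p != 2 -> forall a : W, ~ ord_zero a ->
        forall (X : completeNormedModType (scalar_field R s))
               (iota : {linear c00 (scalar_field R s) -> X}),
        is_completion (S a) p iota ->
        forall es : nat -> dual_space X, coordinate_functionals iota es ->
        forall J : dual_space X -> dual_space X, is_isometry (@dual_norm R s X) J ->
        diagonal_operator es J)
     /\
     (p = 2 ->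
        (forall a : W, successor_ordinal a ->
           forall (X : completeNormedModType (scalar_field R s))
                  (iota : {linear c00 (scalar_field R s) -> X}),
           is_completion (S a) p iota ->
           forall J : X -> X, is_isometry (@vnorm R s X) J ->
           diagonal_operator (unit_vector iota) J)
        /\
        (good_schreier S approx -> forall a : W, ~ ord_zero a ->
           forall (X : completeNormedModType (scalar_field R s))
                  (iota : {linear c00 (scalar_field R s) -> X}),
           is_completion (S a) p iota ->
           forall J : X -> X, is_isometry (@vnorm R s X) J ->
           diagonal_operator (unit_vector iota) J))).
Proof.
split=> [F hF p2 X iota hX|d W S approx hW hS].
  have he := completion_basis hF hp hX; split=> [es hes J hJ|J hJ].
    exact: (dual_isometry_signed_permutation hF he hp hes p2 hJ).
  have [es hes] := coordinate_functionals_exist hF he hp.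
  have [T [hT TE]] := adjoint_isometry hJ.
  apply: (signed_permutation_adjoint hF he hp hes TE).
  exact: (dual_isometry_signed_permutation hF he hp hes p2 hT).
(* An isometry of [X] is read through its adjoint, an isometry of the dual; a diagonal adjoint makes
   [J] diagonal with the same signs. *)
have diag a : ~ ord_zero a -> forall (X : completeNormedModType (scalar_field R s))
    (iota : {linear c00 (scalar_field R s) -> X}), is_completion (S a) p iota ->
    forall J : X -> X, is_isometry (@vnorm R s X) J ->
    diagonal_operator (unit_vector iota) J.
  move=> az X iota hX J hJ; have hF := schreier_combinatorial hW hS a.
  have he := completion_basis hF hp hX.
  have [es hes] := coordinate_functionals_exist hF he hp.
  have [T [hT TE]] := adjoint_isometry hJ.
  apply: (diagonal_adjoint hF he hp hes TE).
  exact: (schreier_isometry_diagonal hF he hp hes hW hS az erefl hT).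
split=> [p2 a az X iota hX es hes J hJ|p2].
  have hF := schreier_combinatorial hW hS a.
  have he := completion_basis hF hp hX.
  exact: (schreier_isometry_diagonal hF he hp hes hW hS az erefl hJ).
split=> [a [b [ba _]]|_ a az]; apply: diag => //.
by move=> az; move: ba; rewrite ltNge az.
Qed.
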